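(* Assume $(X,T)$ has the b.i.p.-property and $\phi$ satisfies (H* ), (S1) and (S2). Then $P_G(\phi)$ is finite and, for a.e. $\omega\in\Omega$, $$\sum_{n\in J_\omega(\Omega^* )}s^n\,\mathcal Z^\omega_n\ \begin{cases}<\infty,& 0<s<e^{-P_G(\phi)},\\ =\infty,& s=e^{-P_G(\phi)}.\end{cases}$$
   Context: Let $(\Omega,\mathcal F,P)$ be a probability space and $\theta:\Omega\to\Omega$ an invertible, bimeasurable, $P$-preserving, ergodic map. Let $\ell:\Omega\to\mathbb N\cup\{\infty\}$ be measurable with $\ell_\omega>1$, and for a.e. $\omega$ let $A_\omega=(\alpha_{ij}(\omega))_{0\le i<\ell_\omega,\,0\le j<\ell_{\theta\omega}}$ be a $\{0,1\}$-matrix depending measurably on $\omega$ such that every row contains an entry $1$. Put $X_\omega=\{x=(x_0,x_1,\dots): x_i<\ell_{\theta^i\omega},\ \alpha_{x_ix_{i+1}}(\theta^i\omega)=1\ \forall i\ge0\}$, $T_\omega:X_\omega\to X_{\theta\omega}$ the left shift, $X=\{(\omega,x):x\in X_\omega\}$, $T^n_\omega=T_{\theta^{n-1}\omega}\circ\cdots\circ T_\omega$. A word $w=(w_0,\dots,w_{n-1})$ is $\omega$-admissible if $w_i<\ell_{\theta^i\omega}$ for all $i<n$ and $\alpha_{w_iw_{i+1}}(\theta^i\omega)=1$ for $i<n-1$; $\mathcal W^n_\omega$ is the set of such words of length $n$; $[w]_\omega=\{x\in X_\omega: x_i=w_i,\ i<n\}$; $\Omega_w=\{\omega: w\in\mathcal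 W^n_\omega\}$; $\mathcal W^n$ is the set of words $w$ of length $n$ with $P(\Omega_w)>0$. $(X,T)$ is topologically mixing if for all $a,b\in\mathcal W^1$ there is an $\mathbb N$-valued random variable $N_{ab}$ with $[a]_\omega\cap(T^n_\omega)^{-1}[b]_{\theta^n\omega}\ne\emptyset$ whenever $\omega\in\Omega_a$, $n\ge N_{ab}(\omega)$, $\theta^n\omega\in\Omega_b$. Big image property: there exist measurable $\Omega_{bi}$ with $P(\Omega_{bi})>0$ and finite sets $\mathcal I^\omega_{bi}\subset\mathcal W^1_\omega$ ($\omega\in\Omega_{bi}$) such that for every $c\in\mathcal W^1_{\theta^{-1}\omega}$ there is $b\in\mathcal I^\omega_{bi}$ with $\alpha_{cb}(\theta^{-1}\omega)=1$. Big preimage property: there exist measurable $\Omega_{bp}$ with $P(\Omega_{bp})>0$ and finite sets $\mathcal I^\omega_{bp}\subset\mathcal W^1_{\theta^{-1}\omega}$ ($\omega\in\Omega_{bp}$) such that for every $c\in\mathcal W^1_\omega$ there is $b\in\mathcal I^\omega_{bp}$ with $\alpha_{bc}(\theta^{-1}\omega)=1$. b.i.p.-property: topologically mixing plus both properties. A potential is a measurable $\phi:X\to\mathbb R$, $(\omega,x)\mapsto\phi^\omega(x)$; $\phi^\omega_n(x)=\sum_{k=0}^{n-1}\phi^{\theta^k\omega}(T^k_\omega x)$; $V^\omega_n(\phi)=\sup\{|\phi^\omega(x)-\phi^\omega(y)|: x_i=y_i\ (i<n)\}$. $\phi$ is $k$-Hölder if there are $r\in(0,1)$ and a random variable $\kappa\ge1$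 with $\int\log\kappa\,dP<\infty$ and $V^\omega_j(\phi)\le\kappa(\omega)r^j$ for all $j\ge k$, a.e. $\omega$; then $B_\omega:=\exp\sum_{j\ge1}\kappa(\theta^{-j}\omega)r^j$. Ruelle operator $L^\omega_\phi f(x)=\sum_{y\in X_\omega,T_\omega y=x}e^{\phi^\omega(y)}f(y)$, $L^{\omega,n}_\phi=L^{\theta^{n-1}\omega}_\phi\circ\cdots\circ L^\omega_\phi$. (H2): $\phi$ is 2-Hölder and $\int\log B\,dP<\infty$. (H* ): (H2) holds and $V^\omega_1(\phi)<\infty$ for a.e. $\omega\in\theta^{-1}(\Omega_{bi}\cup\Omega_{bp})$. (S1): $\int\log M_\omega\,dP<\infty$, $M_\omega=\sup_{x\in X_{\theta\omega}}L^\omega_\phi1(x)$. (S2): $\int\log m_\omega\,dP>-\infty$, $m_\omega=\inf_{x\in X_{\theta\omega}}L^\omega_\phi1(x)$. Fix $a\in\mathcal W^1$ and a measurable family $\xi_\omega\in X_\omega$ with $\xi_\omega\in[a]_\omega$ for $\omega\in\Omega_a$. $\mathcal W^n_\omega(a,a)=\{w\in\mathcal W^n_\omega: w_0=a,\ \alpha_{w_{n-1}a}(\theta^{n-1}\omega)=1\}$; $e^{\phi^\omega_m([v])}:=\sup_{x\in[v]_\omega}e^{\phi^\omega_m(x)}$; $Z^\omega_n(a)=\sum_{w\in\mathcal W^n_\omega(a,a)}e^{\phi^\omega_n([wa])}$; $\mathcal Z^\omega_n=L^{\omega,n}_\phi(1)(\xi_{\theta^n\omega})$. $J_\omega(\Omega')=\{n\in\mathbb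 N:\theta^n\omega\in\Omega'\}$. Fix $N$ such that $\Omega^*=\{\omega\in\Omega_a:N_{aa}(\omega)\le N\}$ has positive measure. $P_G(\phi)=\lim_{n\to\infty,n\in J_\omega(\Omega^* )}\frac1n\log Z^\omega_n(a)$ (relative Gurevič pressure), which exists for a.e. $\omega\in\Omega^*$, is a.s. constant and independent of $a,N$. *)

(* Defs.v *)
From mathcomp Require Import all_boot all_order all_algebra.
From mathcomp Require Import all_classical all_reals all_analysis.
Import Order.TTheory GRing.Theory Num.Theory.

Set Implicit Arguments.
Unset Strict Implicit.
Unset Printing Implicit Defensive.

Local Open Scope classical_set_scope.
Local Open Scope ring_scope.

(* Alphabet symbols are natural numbers.  ell : Omega -> option nat     *)
(* encodes  ell_omega in N \cup {oo}  (None = oo).  The random matrix   *)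
(* A_omega is encoded by alpha : Omega -> nat -> nat -> bool; only its  *)
(* entries alpha w i j with i < ell_w, j < ell_(theta w) are ever used. *)
(* theta^n is  iter n theta,  theta^{-n} is  iter n thinv.              *)

Definition ell_lt (l : option nat) (i : nat) : bool :=
  if l is Some n then (i < n)%N else true.

Definition inX (Omega : Type) (theta : Omega -> Omega) (ell : Omega -> option nat)
  (alpha : Omega -> nat -> nat -> bool) (w : Omega) (x : nat -> nat) : Prop :=
  forall i : nat, ell_lt (ell (iter i theta w)) (x i) /\
                  alpha (iter i theta w) (x i) (x i.+1).

Definition admissible (Omega : Type) (theta : Omega -> Omega) (ell : Omega -> option nat)
  (alpha : Omega -> nat -> nat -> bool) (w : Omega) (v : seq nat) : Prop :=
  (forall i : nat, (i < size v)%N -> ell_lt (ell (iter i theta w)) (nth 0%N v i)) /\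
  (forall i : nat, (i.+1 < size v)%N ->
     alpha (iter i theta w) (nth 0%N v i) (nth 0%N v i.+1)).

Definition cyl (Omega : Type) (theta : Omega -> Omega) (ell : Omega -> option nat)
  (alpha : Omega -> nat -> nat -> bool) (w : Omega) (v : seq nat) : set (nat -> nat) :=
  [set x | inX theta ell alpha w x /\ forall i, (i < size v)%N -> x i = nth 0%N v i].

Definition Omega_w (Omega : Type) (theta : Omega -> Omega) (ell : Omega -> option nat)
  (alpha : Omega -> nat -> nat -> bool) (v : seq nat) : set Omega :=
  [set w | admissible theta ell alpha w v].

Definition inW (d : measure_display) (Omega : measurableType d) (R : realType)
  (P : probability Omega R) (theta : Omega -> Omega) (ell : Omega -> option nat)
  (alpha : Omega -> nat -> nat -> bool) (v : seq nat) : Prop :=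
  (0 < P (Omega_w theta ell alpha v))%E.

Definition nat_rv (d : measure_display) (Omega : measurableType d) (N : Omega -> nat) :=
  forall k : nat, measurable [set w | N w = k].

Definition mixing_for (Omega : Type) (theta : Omega -> Omega) (ell : Omega -> option nat)
  (alpha : Omega -> nat -> nat -> bool) (a b : nat) (Nab : Omega -> nat) : Prop :=
  forall (w : Omega) (n : nat),
    Omega_w theta ell alpha [:: a] w -> (Nab w <= n)%N ->
    Omega_w theta ell alpha [:: b] (iter n theta w) ->
    exists x, inX theta ell alpha w x /\ x 0%N = a /\ x n = b.

Definition top_mixing (d : measure_display) (Omega : measurableType d) (R : realType)
  (P : probability Omega R) (theta : Omega -> Omega) (ell : Omega -> option nat)
  (alpha : Omega -> nat -> nat -> bool) : Prop :=
  forall a b : nat, inW P theta ell alpha [:: a] -> inW P theta ell alpha [:: b] ->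
    exists Nab : Omega -> nat, nat_rv Nab /\ mixing_for theta ell alpha a b Nab.

Definition big_image_prop (d : measure_display) (Omega : measurableType d) (R : realType)
  (P : probability Omega R) (thinv : Omega -> Omega) (ell : Omega -> option nat)
  (alpha : Omega -> nat -> nat -> bool) (Obi : set Omega) (Ibi : Omega -> seq nat) : Prop :=
  measurable Obi /\ (0 < P Obi)%E /\
  forall w, Obi w ->
    (forall b, b \in Ibi w -> ell_lt (ell w) b) /\
    (forall c, ell_lt (ell (thinv w)) c -> exists2 b, b \in Ibi w & alpha (thinv w) c b).

Definition big_preimage_prop (d : measure_display) (Omega : measurableType d) (R : realType)
  (P : probability Omega R) (thinv : Omega -> Omega) (ell : Omega -> option nat)
  (alpha : Omega -> nat -> nat -> bool) (Obp : set Omega) (Ibp : Omega -> seq nat) : Prop :=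
  measurable Obp /\ (0 < P Obp)%E /\
  forall w, Obp w ->
    (forall b, b \in Ibp w -> ell_lt (ell (thinv w)) b) /\
    (forall c, ell_lt (ell w) c -> exists2 b, b \in Ibp w & alpha (thinv w) b c).

Definition shiftk (k : nat) (x : nat -> nat) : nat -> nat := fun i => x (i + k)%N.

Definition birkhoff (Omega : Type) (R : realType) (theta : Omega -> Omega)
  (phi : Omega -> (nat -> nat) -> R) (n : nat) (w : Omega) (x : nat -> nat) : R :=
  \sum_(k < n) phi (iter k theta w) (shiftk k x).

Definition cylN (v : seq nat) : set (nat -> nat) :=
  [set x | forall i, (i < size v)%N -> x i = nth 0%N v i].

Definition Xset (Omega : Type) (theta : Omega -> Omega) (ell : Omega -> option nat)
  (alpha : Omega -> nat -> nat -> bool) : set (Omega * (nat -> nat)) :=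
  [set p | inX theta ell alpha p.1 p.2].

(* phi : X -> R is measurable for the trace on X of the product sigma-algebra
   F (x) (product sigma-algebra of N^N), i.e. the sigma-algebra on X generated
   by the sets X \cap (A x [v]), A in F, v a finite word. *)
Definition measurable_potential (d : measure_display) (Omega : measurableType d)
  (R : realType) (theta : Omega -> Omega) (ell : Omega -> option nat)
  (alpha : Omega -> nat -> nat -> bool) (phi : Omega -> (nat -> nat) -> R) : Prop :=
  let D := Xset theta ell alpha in
  let G := [set E | exists (A : set Omega) (v : seq nat),
                      measurable A /\ E = D `&` (A `*` cylN v)] in
  forall B : set R, measurable B -> <<s D, G >> (D `&` [set p | B (phi p.1 p.2)]).

Definition Var_phi (Omega : Type) (R : realType) (theta : Omega -> Omega)
  (ell : Omega -> option nat) (alpha : Omega -> nat -> nat -> bool)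
  (phi : Omega -> (nat -> nat) -> R) (n : nat) (w : Omega) : \bar R :=
  ereal_sup ([set 0%E] `|`
    [set e | exists x y : nat -> nat,
       inX theta ell alpha w x /\ inX theta ell alpha w y /\
       (forall i, (i < n)%N -> x i = y i) /\ e = (`|phi w x - phi w y|)%:E]).

Definition holder (d : measure_display) (Omega : measurableType d) (R : realType)
  (P : probability Omega R) (theta : Omega -> Omega) (ell : Omega -> option nat)
  (alpha : Omega -> nat -> nat -> bool) (phi : Omega -> (nat -> nat) -> R)
  (k : nat) (r : R) (kappa : Omega -> R) : Prop :=
  0 < r < 1 /\ measurable_fun setT kappa /\ (forall w, 1 <= kappa w) /\
  (\int[P]_w (ln (kappa w))%:E < +oo)%E /\
  {ae P, forall w, forall j : nat, (k <= j)%N ->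
     (Var_phi theta ell alpha phi j w <= (kappa w * r ^+ j)%:E)%E}.

Definition logB (Omega : Type) (R : realType) (thinv : Omega -> Omega)
  (kappa : Omega -> R) (r : R) (w : Omega) : \bar R :=
  (\sum_(1 <= j <oo) (kappa (iter j thinv w) * r ^+ j)%:E)%E.

Definition H2 (d : measure_display) (Omega : measurableType d) (R : realType)
  (P : probability Omega R) (theta thinv : Omega -> Omega) (ell : Omega -> option nat)
  (alpha : Omega -> nat -> nat -> bool) (phi : Omega -> (nat -> nat) -> R) : Prop :=
  exists (r : R) (kappa : Omega -> R),
    holder P theta ell alpha phi 2 r kappa /\
    (\int[P]_w logB thinv kappa r w < +oo)%E.

Definition Hstar (d : measure_display) (Omega : measurableType d) (R : realType)
  (P : probability Omega R) (theta thinv : Omega -> Omega) (ell : Omega -> option nat)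
  (alpha : Omega -> nat -> nat -> bool) (phi : Omega -> (nat -> nat) -> R)
  (Obi Obp : set Omega) : Prop :=
  H2 P theta thinv ell alpha phi /\
  {ae P, forall w, (Obi `|` Obp) (theta w) -> (Var_phi theta ell alpha phi 1 w < +oo)%E}.

Definition pre (c : nat) (x : nat -> nat) : nat -> nat :=
  fun i => if i is j.+1 then x j else c.

(* L^omega_phi f (x) = sum_{y in X_omega, T y = x} e^{phi^omega(y)} f(y) *)
Definition Ruelle (Omega : Type) (R : realType) (theta : Omega -> Omega)
  (ell : Omega -> option nat) (alpha : Omega -> nat -> nat -> bool)
  (phi : Omega -> (nat -> nat) -> R) (w : Omega) (f : (nat -> nat) -> \bar R)
  (x : nat -> nat) : \bar R :=
  (\esum_(c in [set c | inX theta ell alpha w (pre c x)])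
     ((expR (phi w (pre c x)))%:E * f (pre c x)))%E.

Fixpoint RuelleN (Omega : Type) (R : realType) (theta : Omega -> Omega)
  (ell : Omega -> option nat) (alpha : Omega -> nat -> nat -> bool)
  (phi : Omega -> (nat -> nat) -> R) (n : nat) (w : Omega)
  (f : (nat -> nat) -> \bar R) : (nat -> nat) -> \bar R :=
  match n with
  | 0 => f
  | m.+1 => Ruelle theta ell alpha phi (iter m theta w)
              (RuelleN theta ell alpha phi m w f)
  end.

Definition elog (R : realType) (x : \bar R) : \bar R :=
  match x with
  | EFin r => if (0 < r)%R then (ln r)%:E else -oo%E
  | +oo%E => +oo%E
  | -oo%E => -oo%E
  end.

Definition Mw (Omega : Type) (R : realType) (theta : Omega -> Omega)
  (ell : Omega -> option nat) (alpha : Omega -> nat -> nat -> bool)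
  (phi : Omega -> (nat -> nat) -> R) (w : Omega) : \bar R :=
  ereal_sup [set Ruelle theta ell alpha phi w (fun _ => 1%E) x
            | x in [set x | inX theta ell alpha (theta w) x]].

Definition mw (Omega : Type) (R : realType) (theta : Omega -> Omega)
  (ell : Omega -> option nat) (alpha : Omega -> nat -> nat -> bool)
  (phi : Omega -> (nat -> nat) -> R) (w : Omega) : \bar R :=
  ereal_inf [set Ruelle theta ell alpha phi w (fun _ => 1%E) x
            | x in [set x | inX theta ell alpha (theta w) x]].

(* (S1): int log M dP < oo, i.e. the positive part of log M has finite integral *)
Definition S1 (d : measure_display) (Omega : measurableType d) (R : realType)
  (P : probability Omega R) (theta : Omega -> Omega) (ell : Omega -> option nat)
  (alpha : Omega -> nat -> nat -> bool) (phi : Omega -> (nat -> nat) -> R) : Prop :=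
  (\int[P]_w maxe (elog (Mw theta ell alpha phi w)) 0 < +oo)%E.

(* (S2): int log m dP > -oo, i.e. the negative part of log m has finite integral *)
Definition S2 (d : measure_display) (Omega : measurableType d) (R : realType)
  (P : probability Omega R) (theta : Omega -> Omega) (ell : Omega -> option nat)
  (alpha : Omega -> nat -> nat -> bool) (phi : Omega -> (nat -> nat) -> R) : Prop :=
  (\int[P]_w maxe (- elog (mw theta ell alpha phi w)) 0 < +oo)%E.

(* e^{phi_m^omega([v])} = sup_{x in [v]_omega} e^{phi_m^omega(x)}  (0 if [v] empty) *)
Definition supexp (Omega : Type) (R : realType) (theta : Omega -> Omega)
  (ell : Omega -> option nat) (alpha : Omega -> nat -> nat -> bool)
  (phi : Omega -> (nat -> nat) -> R) (m : nat) (w : Omega) (v : seq nat) : \bar R :=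
  ereal_sup ([set 0%E] `|`
    [set (expR (birkhoff theta phi m w x))%:E | x in cyl theta ell alpha w v]).

Definition Waa (Omega : Type) (theta : Omega -> Omega) (ell : Omega -> option nat)
  (alpha : Omega -> nat -> nat -> bool) (n : nat) (w : Omega) (a : nat) : set (seq nat) :=
  [set v | size v = n /\ admissible theta ell alpha w v /\ nth 0%N v 0 = a /\
           alpha (iter n.-1 theta w) (nth 0%N v n.-1) a].

Definition Zn (Omega : Type) (R : realType) (theta : Omega -> Omega)
  (ell : Omega -> option nat) (alpha : Omega -> nat -> nat -> bool)
  (phi : Omega -> (nat -> nat) -> R) (a n : nat) (w : Omega) : \bar R :=
  (\esum_(v in Waa theta ell alpha n w a) supexp theta ell alpha phi n w (rcons v a))%E.

Definition calZ (Omega : Type) (R : realType) (theta : Omega -> Omega)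
  (ell : Omega -> option nat) (alpha : Omega -> nat -> nat -> bool)
  (phi : Omega -> (nat -> nat) -> R) (xi : Omega -> nat -> nat) (n : nat) (w : Omega)
  : \bar R :=
  RuelleN theta ell alpha phi n w (fun _ => 1%E) (xi (iter n theta w)).

Definition Jset (Omega : Type) (theta : Omega -> Omega) (O' : set Omega) (w : Omega)
  : set nat := [set n | (0 < n)%N /\ O' (iter n theta w)].

Definition Ostar (Omega : Type) (theta : Omega -> Omega) (ell : Omega -> option nat)
  (alpha : Omega -> nat -> nat -> bool) (a : nat) (Naa : Omega -> nat) (N : nat)
  : set Omega :=
  [set w | Omega_w theta ell alpha [:: a] w /\ (Naa w <= N)%N].

Definition cvg_along (R : realType) (J : set nat) (u : nat -> \bar R) (p : R) : Prop :=
  forall e : R, 0 < e -> exists n0 : nat, forall n : nat, (n0 <= n)%N -> J n ->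
    exists z : R, u n = z%:E /\ `|z - p| < e.

(* Main.v *)
(* Let Lam_n(w) and lam_n(w) be the supremum and the infimum of L^{w,n} 1 over
   X_{theta^n w}.  Then log Lam is a subadditive and log lam a superadditive cocycle
   over theta, and (S1), (S2) make both integrable, so Kingman's theorem applies.
   When theta^n w visits a suitable set of positive measure, big images and mixing
   allow one to join the last letter of any word of length n to any point q steps
   later at a bounded cost, whence Lam_n <= k lam_{n+q}; so both cocycles have the
   same growth rate PG.  The quantity calZ_n lies between lam_n and Lam_n, which
   gives convergence for s < exp(- PG); Z_n(a) is compared with them by bounded
   distortion (where log B(theta^n w) = o(n) enters) and, for the lower bound, by a
   connecting word from a.  At s = exp(- PG) the cocycle log Lam_n - n PG has
   nonnegative integrals, and such a cocycle cannot tend to -oo along the visits to a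
   set of positive measure; hence infinitely many terms are bounded below. *)

Require Import Defs.
From mathcomp Require Import all_boot all_order all_algebra.
From mathcomp Require Import all_classical all_reals all_analysis.
From mathcomp Require Import measurable_realfun.
From mathcomp Require Import lra ring zify.
Import Order.TTheory GRing.Theory Num.Theory.
Import numFieldNormedType.Exports.
Local Open Scope classical_set_scope.
Local Open Scope ring_scope.

Set Implicit Arguments.
Unset Strict Implicit.
Unset Printing Implicit Defensive.

(** * Integrable real functions *)

(** The points of X_w form an uncountable random set, so [M_w] and [m_w] need not be measurable. The
    extrema of the iterates are therefore taken over a countable family of measurable sections;
    bounded distortion makes them agree with the true extrema, and the integrals in (S1) and (S2)
    serve only as lower integrals that dominate measurable functions. The constant that joins Lam_n
    to lam_{n+q} must not depend on n. All its ingredients (variation, distortion, connecting word)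
    sit at the end of the orbit segment, so invertibility of theta lets the comparison be phrased as
    a measurable set of endpoints, with a condition on all their pasts, and recurrence applies to
    this fixed set. Almost sure linear growth cannot decide the case s = exp(- PG): an error o(n)
    may still drive the terms to 0. Kingman's theorem is therefore proved together with its bound on
    the integrals, and the stopping estimate behind it is used once more for the critical
    recurrence. *)

Section RealIntegrals.
Context (d : measure_display) (Omega : measurableType d) (R : realType)
  (P : probability Omega R).
Implicit Types f g : Omega -> R.

Definition intble f := P.-integrable setT (EFin \o f).

Lemma intble_meas f : intble f -> measurable_fun setT f.
Proof. by move=> /measurable_int /measurable_EFinP. Qed.

Lemma intbleD f g : intble f -> intble g -> intble (fun w => f w + g w).
Proof. by move=> hf hg; apply: eq_integrable (integrableD measurableT hf hg). Qed.

Lemma intbleZ (k : R) f : intble f -> intble (fun w => k * f w).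
Proof. by move=> hf; apply: eq_integrable (integrableZl measurableT k hf). Qed.

Lemma intbleN f : intble f -> intble (fun w => - f w).
Proof. by move=> hf; apply: eq_integrable (integrableN hf). Qed.

Lemma intble_abs f : intble f -> intble (fun w => `|f w|).
Proof. by move=> hf; apply: eq_integrable (integrable_abse hf). Qed.

Lemma intble_cst (k : R) : intble (fun=> k).
Proof. exact: (finite_measure_integrable_cst P k). Qed.

Lemma intble_sum (n : nat) (h : nat -> Omega -> R) :
  (forall i, intble (h i)) -> intble (fun w => \sum_(i < n) h i w).
Proof.
move=> hh; elim: n => [|n IH].
  by under eq_fun do rewrite big_ord0; exact: intble_cst.
by under eq_fun do rewrite big_ord_recr; apply: intbleD.
Qed.

Lemma intble_le f g : measurable_fun setT f -> intble g ->
  {ae P, forall w, `|f w| <= g w} -> intble f.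
Proof.
move=> mf ig ae; apply/integrableP; split; first exact/measurable_EFinP.
have /integrableP[mg /(le_lt_trans _)] := ig; apply.
apply: ae_ge0_le_integral => //.
- by apply: measurableT_comp => //; exact/measurable_EFinP.
- exact: measurableT_comp.
- apply: filterS ae => w h _ /=.
  by rewrite lee_fin; apply: le_trans h (ler_norm _).
Qed.

Lemma Eae_le f g : intble f -> intble g -> {ae P, forall w, f w <= g w} ->
  \int[P]_w f w <= \int[P]_w g w.
Proof.
move=> hf hg ae.
rewrite -subr_ge0 -RintegralB//.
rewrite /Rintegral; apply: fine_ge0.
(* The difference is nonnegative only almost everywhere; its absolute value has the same integral
   and is nonnegative everywhere. *)
have -> : (\int[P]_x (g x - f x)%:E = \int[P]_x `|g x - f x|%:E)%E.
  apply: ae_eq_integral => //.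
  - apply/measurable_EFinP; apply: measurable_funB; exact: intble_meas.
  - apply/measurable_EFinP; apply: measurableT_comp => //.
    apply: measurable_funB; exact: intble_meas.
  - apply: filterS ae => w h _; by rewrite ger0_norm// subr_ge0.
by apply: integral_ge0 => w _; rewrite lee_fin.
Qed.

Lemma Esum (n : nat) (h : nat -> Omega -> R) :
  (forall i, intble (h i)) ->
  \int[P]_w (\sum_(i < n) h i w) = \sum_(i < n) \int[P]_w h i w.
Proof.
move=> hh; elim: n => [|n IH].
  rewrite big_ord0; under eq_Rintegral do rewrite big_ord0.
  by rewrite Rintegral_cst// mul0r.
rewrite big_ord_recr /= -IH -RintegralD//; [|exact: intble_sum|exact: hh].
by apply: eq_Rintegral => w _; rewrite big_ord_recr.
Qed.

Lemma Ecst (k : R) : \int[P]_w k = k.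
Proof. by rewrite Rintegral_cst//= probability_setT mulr1. Qed.

End RealIntegrals.

(** * Subadditive cocycles over an ergodic map *)

Section MeasurePreserving.
Context (d : measure_display) (Omega : measurableType d) (R : realType)
  (P : probability Omega R).
Variables (theta thinv : Omega -> Omega).
Hypotheses (th_can : cancel theta thinv) (thinv_can : cancel thinv theta).
Hypotheses (th_meas : measurable_fun setT theta)
  (thinv_meas : measurable_fun setT thinv).
Hypothesis th_pres : forall A : set Omega, measurable A -> P (theta @^-1` A) = P A.
Hypothesis th_erg : forall A : set Omega, measurable A -> theta @^-1` A = A ->
  P A = 0%E \/ P A = 1%E.
Implicit Types f g : Omega -> R.

Lemma iter_meas n : measurable_fun setT (iter n theta).
Proof. by elim: n => [|n IH]; [exact: measurable_id|exact: measurableT_comp]. Qed.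

Lemma iterinv_meas n : measurable_fun setT (iter n thinv).
Proof. by elim: n => [|n IH]; [exact: measurable_id|exact: measurableT_comp]. Qed.

Lemma preimage_meas (A : set Omega) (h : Omega -> Omega) :
  measurable_fun setT h -> measurable A -> measurable (h @^-1` A).
Proof. by move=> mh mA; rewrite -[_ @^-1` _]setTI; exact: mh. Qed.

Lemma iter_pres n A : measurable A -> P (iter n theta @^-1` A) = P A.
Proof.
move=> mA; elim: n => [//|n IH]; rewrite -IH -(th_pres (A := iter n theta @^-1` A)).
  by congr (P _); apply/seteqP; split => w /=; rewrite -iterSr.
exact: preimage_meas (@iter_meas n) mA.
Qed.

Lemma thinv_pres A : measurable A -> P (thinv @^-1` A) = P A.
Proof.
move=> mA; rewrite -th_pres; last exact: preimage_meas.
by congr (P _); apply/seteqP; split => w /=; rewrite th_can.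
Qed.

Lemma iterinv_pres n A : measurable A -> P (iter n thinv @^-1` A) = P A.
Proof.
move=> mA; elim: n => [//|n IH]; rewrite -IH -(thinv_pres (A := iter n thinv @^-1` A)).
  by congr (P _); apply/seteqP; split => w /=; rewrite -iterSr.
exact: preimage_meas (@iterinv_meas n) mA.
Qed.

Lemma iterK n : cancel (iter n theta) (iter n thinv).
Proof. by elim: n => [//|n IH] w; rewrite (iterSr n thinv) iterS th_can IH. Qed.

Lemma iterKV n : cancel (iter n thinv) (iter n theta).
Proof. by elim: n => [//|n IH] w; rewrite (iterSr n theta) iterS thinv_can IH. Qed.

Lemma ae_preim (h : Omega -> Omega) (Q : Omega -> Prop) :
  measurable_fun setT h -> (forall A, measurable A -> P (h @^-1` A) = P A) ->
  {ae P, forall w, Q w} -> {ae P, forall w, Q (h w)}.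
Proof.
move=> mh ph [A [mA PA sA]]; exists (h @^-1` A); split.
- exact: preimage_meas.
- by rewrite ph.
- by move=> w /= nQ; apply: sA.
Qed.

(** Preimages of a null set under all iterates are null, and there are countably many. Every
    argument along an orbit starts by fixing such a point. *)
Lemma ae_orbit (Q : Omega -> Prop) : {ae P, forall w, Q w} ->
  {ae P, forall w, forall n, Q (iter n theta w) /\ Q (iter n thinv w)}.
Proof.
move=> aeQ; apply: ae_foralln => n.
have h1 := ae_preim (@iter_meas n) (iter_pres n) aeQ.
have h2 := ae_preim (@iterinv_meas n) (iterinv_pres n) aeQ.
by apply: filterS2 h1 h2.
Qed.

Lemma ge0_int_comp (g : Omega -> \bar R) : measurable_fun setT g ->
  (forall w, (0 <= g w)%E) -> (\int[P]_w g (theta w) = \int[P]_w g w)%E.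
Proof.
move=> mg g0.
rewrite -[X in integral _ X _](preimage_setT theta).
rewrite -(ge0_integral_pushforward th_meas)//.
by apply: eq_measure_integral => A mA _ /=; rewrite -[RHS]th_pres.
Qed.

Lemma intble_comp f : intble P f -> intble P (fun w => f (theta w)).
Proof.
move=> hf; have mf := intble_meas hf.
apply/integrableP; split.
  by apply/measurable_EFinP; apply: (measurableT_comp mf).
have /integrableP[mg] := hf.
rewrite (ge0_int_comp (g := fun w => `|(f w)%:E|%E))//.
exact: measurableT_comp.
Qed.

Lemma E_comp f : intble P f -> \int[P]_w f (theta w) = \int[P]_w f w.
Proof.
move=> hf; have mf := intble_meas hf; rewrite /Rintegral; congr fine.
rewrite -[X in integral _ X _](preimage_setT theta).
rewrite -(integral_pushforward th_meas (f := EFin \o f))//.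
- by apply: eq_measure_integral => A mA _ /=; rewrite -[RHS]th_pres.
- exact/measurable_EFinP.
- by rewrite preimage_setT; exact: intble_comp.
Qed.

Lemma intble_iter f n : intble P f -> intble P (fun w => f (iter n theta w)).
Proof.
move=> hf; elim: n => [//|n IH].
by under eq_fun do rewrite iterSr; exact: (intble_comp (f := fun w => f (iter n theta w))).
Qed.

Lemma E_iter f n : intble P f -> \int[P]_w f (iter n theta w) = \int[P]_w f w.
Proof.
move=> hf; elim: n => [//|n IH].
under eq_Rintegral do rewrite iterSr.
by rewrite (E_comp (f := fun w => f (iter n theta w)))//; exact: intble_iter.
Qed.

(** Visiting [A] infinitely often is a strictly invariant event. It is the decreasing limit of the
    events [U n], each of measure at least [P A], so ergodicity makes it full. *)
Lemma recurrence A : measurable A -> (0 < P A)%E ->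
  {ae P, forall w, forall n0, exists2 n, (n0 <= n)%N & A (iter n theta w)}.
Proof.
move=> mA PA.
pose U n := \bigcup_(k in [set k | (n <= k)%N]) (iter k theta @^-1` A).
pose F := \bigcap_n U n.
have mU n : measurable (U n).
  apply: bigcup_measurable => k _; exact: preimage_meas (@iter_meas k) mA.
have mF : measurable F by apply: bigcap_measurable => //.
have FE : theta @^-1` F = F.
  apply/seteqP; split => w Fw n _.
    have [k /= nk Ak] := Fw n I; exists k.+1 => /=; first exact: leqW.
    by rewrite -iterS iterSr.
  have [k /= nk Ak] := Fw n.+1 I; case: k nk Ak => // k nk Ak.
  by exists k => //=; rewrite -iterSr.
have PF : (P A <= P F)%E.
  have cv : (P \o U) x @[x --> \oo] --> P F.
    apply: nonincreasing_cvg_mu => //; first by rewrite ltey_eq fin_num_measure.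
    move=> n m nm; apply/subsetPset => w [k /= mk Ak]; exists k => //=.
    exact: leq_trans nm mk.
  apply: (cvge_to_ge cv); apply: nearW => n /=; rewrite -(iter_pres n mA).
  apply: le_measure; rewrite ?inE//; first exact: preimage_meas (@iter_meas n) mA.
  by move=> w Aw; exists n => /=.
have PF1 : P F = 1%E.
  by case: (th_erg mF FE) => // F0; rewrite F0 leNgt PA in PF.
exists (~` F); split; first exact: measurableC.
- by by rewrite probability_setC// PF1 subee.
- move=> w /= nw Fw; apply: nw => n0.
  by have [k /= nk Ak] := Fw n0 I; exists k.
Qed.

(** Almost every orbit enters [F], and the implication pulls membership back along the orbit to its
    starting point. *)
Lemma semi_invariant F : measurable F -> (0 < P F)%E ->
  {ae P, forall w, F (theta w) -> F w} -> {ae P, forall w, F w}.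
Proof.
move=> mF PF sF; have h1 := recurrence mF PF; have h2 := ae_orbit sF.
apply: filterS2 h1 h2 => w /(_ 0%N)[n _ Fn] h.
elim: n Fn => [//|n IH Fn]; apply: IH; exact: (h n).1.
Qed.

Definition subadd (b : nat -> Omega -> R) :=
  {ae P, forall w, forall m n, b (m + n)%N w <= b m w + b n (iter m theta w)}.

Lemma window_sum (n L : nat) (C : R) : 0 <= C ->
  \sum_(i < n) (if (n <= i + L)%N then C else 0) <= L%:R * C.
Proof.
move=> C0; elim: n => [|n IH]; first by rewrite big_ord0 mulr_ge0.
have [nL|Ln] := ltnP n L.
  apply: (@le_trans _ _ (\sum_(i < n.+1) C)).
    by apply: ler_sum => i _; case: ifP.
  by rewrite sumr_const card_ord -[C *+ _]mulr_natl ler_wpM2r// ler_nat.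
rewrite big_ord_recl /= add0n ltnNge Ln /= add0r.
by apply: le_trans IH; apply: ler_sum => i _.
Qed.

(** The bad sets decrease to a null set as [L] grows, and [|b 1|] dominates the integrands. *)
Lemma small_tail (b : nat -> Omega -> R) (bI : forall n, intble P (b n)) (e : R) :
  {ae P, forall w, exists2 n, (0 < n)%N & b n w <= 0} -> 0 < e ->
  exists2 L : nat, measurable [set w | forall n, (0 < n <= L)%N -> 0 < b n w]
    & \int[P]_w (`|b 1%N w| * \1_([set w | forall n, (0 < n <= L)%N -> 0 < b n w]) w) <= e.
Proof.
move=> bneg e0.
pose A L := [set w | forall n, (0 < n <= L)%N -> 0 < b n w].
have mA L : measurable (A L).
  rewrite (_ : A L = \bigcap_(n in [set n | (0 < n <= L)%N]) (b n @^-1` `]0, +oo[)).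
    apply: bigcap_measurableType => n _; rewrite -[_ @^-1` _]setTI.
    exact: (intble_meas (bI n)).
  apply/seteqP; split => w h n /= hn; have := h n hn; by rewrite /= in_itv /= andbT.
pose f L w := (`|b 1%N w| * \1_(A L) w)%:E.
have mf L : measurable_fun setT (f L).
  apply/measurable_EFinP; apply: measurable_funM => //.
  by apply: measurableT_comp => //; exact: intble_meas.
have [] := @dominated_convergence _ _ _ P setT measurableT f (cst 0%E)
   (EFin \o (fun w => `|b 1%N w|)) mf.
- exact: measurable_cst.
- apply: filterS bneg => w [n n0 bn] _.
  apply: (@cvg_near_cst _ _ _ _ _ _); near=> L.
  rewrite /f /= indicE memNset ?mulr0// => /(_ n); rewrite n0 /=.
  suff -> : (n <= L)%N by rewrite ltNge bn => /(_ isT).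
  near: L; exact: nbhs_infty_ge.
- exact: intble_abs.
- apply: aeW => w n _; rewrite /f /= lee_fin normrM normr_id ler_piMr//.
  by rewrite indicE; case: (_ \in _); rewrite ?normr1 ?normr0.
move=> _ _; rewrite integral_cst// mul0e => cv.
have : \forall L \near \oo, (\int[P]_w f L w < e%:E)%E.
  apply: (cv [set y | (y < e%:E)%E]); apply: open_nbhs_nbhs; split; first exact: open_ereal_lt_ereal.
  by rewrite /= lte_fin.
move=> [L _ /(_ L (leqnn _)) h]; exists L; first exact: mA.
rewrite -lee_fin /Rintegral fineK; first exact: ltW.
have : intble P (fun w => `|b 1%N w| * \1_(A L) w).
  apply: intble_le (intble_abs (bI 1%N)) _.
    exact/measurable_EFinP/mf.
  apply: aeW => w; rewrite normrM normr_id ler_piMr//.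
  by rewrite indicE; case: (_ \in _); rewrite ?normr1 ?normr0.
exact: integrable_fin_num.
Unshelve. all: by end_near. Qed.

(* Cut the orbit segment greedily into blocks on which b is nonpositive: only points
   that wait longer than L for such a block, and the last L points, remain. *)
Lemma subadd_stopping (b : nat -> Omega -> R) (e : R) :
  {ae P, forall w, b 0%N w = 0} -> (forall n, intble P (b n)) -> subadd b ->
  {ae P, forall w, exists2 n, (0 < n)%N & b n w <= 0} -> 0 < e ->
  exists2 n, (0 < n)%N & \int[P]_w b n w <= e * n%:R.
Proof.
move=> b0 bI bsub bneg e0.
have e20 : 0 < e / 2 by lra.
have [L mA hL] := small_tail bI bneg e20.
set A := [set w | _] in mA hL.
pose g w := `|b 1%N w| * \1_A w.
have g0 w : 0 <= g w by rewrite mulr_ge0// indicE.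
have gI : intble P g.
  apply: intble_le (intble_abs (bI 1%N)) _.
    apply: measurable_funM => //.
    by apply: measurableT_comp => //; exact: intble_meas.
  apply: aeW => w; rewrite normrM normr_id ler_piMr//.
  by rewrite indicE; case: (_ \in _); rewrite ?normr1 ?normr0.
(* The price charged to position i: [|b 1|] on the last [L] positions, and elsewhere only at bad
   points. *)
pose t n i w := if (n <= i + L)%N then `|b 1%N w| else g w.
have t0 n i w : 0 <= t n i w by rewrite /t; case: ifP.
have tI n i : intble P (t n i).
  by rewrite /t; case: (n <= i + L)%N => //; exact: intble_abs.
have key : {ae P, forall w, forall n, b n w <= \sum_(i < n) t n i (iter i theta w)}.
  have h := ae_orbit b0; have h' := ae_orbit bsub.
  apply: filterS2 h h' => w h h' n.
  have {h h'} : forall k, b 0%N (iter k theta w) = 0 /\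
      forall m n, b (m + n)%N (iter k theta w) <=
         b m (iter k theta w) + b n (iter (m + k) theta w).
    by move=> k; rewrite (h k).1; split => // m p; rewrite iterD; exact: (h' k).1.
  (* A bad starting point is removed alone, a good one together with its nonpositive block of length
     k <= L. A block that overshoots the segment leaves only positions among the last [L]. *)
  elim/ltn_ind: n w => n IH w hw.
  have hw' k : forall k', b 0%N (iter k' theta (iter k theta w)) = 0 /\
      forall m n, b (m + n)%N (iter k' theta (iter k theta w)) <=
      b m (iter k' theta (iter k theta w)) + b n (iter (m + k') theta (iter k theta w)).
    move=> k'; rewrite -iterD; split=> [|m p]; first exact: (hw _).1.
    by rewrite -iterD -addnA; exact: (hw _).2.
  have one m : b m w <= \sum_(i < m) `|b 1%N (iter i theta w)|.
    elim: m => [|m IHm]; first by rewrite big_ord0 (hw 0%N).1.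
    rewrite big_ord_recr /= -addn1; apply: le_trans ((hw 0%N).2 m 1%N) _ => /=.
    by rewrite addn0 lerD// ler_norm.
  case: n IH => [|n] IH; first by rewrite big_ord0 (hw 0%N).1.
  have [Aw|nAw] := pselect (A w).
    rewrite big_ord_recl /=; apply: le_trans ((hw 0%N).2 1%N n) _ => /=.
    apply: lerD.
      rewrite /t; case: ifP => _; first exact: ler_norm.
      by rewrite /g indicE mem_set// mulr1 ler_norm.
    apply: le_trans (IH n (ltnSn n) (theta w) (hw' 1%N)) _.
    by apply: ler_sum => i _; rewrite -iterSr.
  have [k kL bk] : exists2 k, (0 < k <= L)%N & b k w <= 0.
    apply: contrapT => hn; apply: nAw => k hk; rewrite ltNge.
    by apply/negP => bk; apply: hn; exists k.
  have [kn|nk] := leqP k n.+1.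
    have lt : (n.+1 - k < n.+1)%N by lia.
    have := (hw 0%N).2 k (n.+1 - k)%N; rewrite subnKC// addn0 /= => /le_trans; apply.
    apply: (@le_trans _ _ (b (n.+1 - k)%N (iter k theta w))); first by lra.
    apply: le_trans (IH _ lt (iter k theta w) (hw' k)) _.
    rewrite -[leRHS](big_mkord xpredT (fun i => t n.+1 i (iter i theta w))).
    rewrite (big_cat_nat (n := k))//= -[X in _ <= X]/(_ + _) -[X in X <= _]add0r.
    apply: lerD; first exact: sumr_ge0.
    rewrite -[k in \sum_(k <= _ < _) _]add0n big_addn big_mkord.
    (* The test in [t] depends only on the distance to the end, so it survives the removal of the
       first k positions. *)
    apply: ler_sum => i _; rewrite -iterD /t.
    by have -> : (n.+1 - k <= i + L)%N = (n.+1 <= i + k + L)%N by lia.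
  apply: le_trans (one n.+1) _; apply: ler_sum => i _; rewrite /t.
  by have -> : (n.+1 <= i + L)%N by lia.
set C := \int[P]_w `|b 1%N w|.
have C0 : 0 <= C by apply: Rintegral_ge0.
have bound n : \int[P]_w b n w <= n%:R * (e / 2) + L%:R * C.
  apply: (@le_trans _ _ (\int[P]_w \sum_(i < n) t n i (iter i theta w))).
    apply: Eae_le => //.
      by apply: (intble_sum n (h := fun i w => t n i (iter i theta w))) => i; exact: intble_iter.
    by apply: filterS key => w; exact.
  rewrite (Esum n (h := fun i w => t n i (iter i theta w))); last by move=> i; exact: intble_iter.
  apply: (@le_trans _ _ (\sum_(i < n) (e / 2 + (if (n <= i + L)%N then C else 0)))).
    apply: ler_sum => i _; rewrite E_iter// /t; case: (n <= i + L)%N; first by rewrite lerDr ltW.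
    by rewrite addr0.
  rewrite big_split /= sumr_const card_ord -[(e/2) *+ _]mulr_natl lerD//.
  exact: window_sum.
(* The boundary cost [L * C] does not grow with n, so a large n absorbs it in the second half of
   [e]. *)
have [n hn] : exists n : nat, L%:R * C / (e / 2) < n%:R.
  by exists (Num.truncn (L%:R * C / (e / 2))).+1; rewrite truncnS_gt.
exists n.+1 => //; apply: le_trans (bound _) _.
rewrite ltr_pdivrMr// in hn.
have : n%:R * (e / 2) <= n.+1%:R * (e / 2) by rewrite ler_wpM2r ?ler_nat// ltW.
lra.
Qed.

Lemma meas_le f (c : R) : measurable_fun setT f -> measurable [set w | f w <= c].
Proof.
move=> mf; rewrite (_ : [set w | _] = f @^-1` `]-oo, c]).
  by rewrite -[_ @^-1` _]setTI; exact: mf.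
by apply/seteqP; split => w /=; rewrite in_itv.
Qed.

Lemma ae_not_or_pos (F : set Omega) : measurable F ->
  (0 < P F)%E \/ {ae P, forall w, ~ F w}.
Proof.
move=> mF; have [PF|PF] := ltP 0%E (P F); [by left|right].
exists F; split => //.
- by apply/eqP; rewrite eq_le PF measure_ge0.
- by move=> w /= /contrapT.
Qed.

(** By monotonicity the values 1/(n+1) suffice, so the quantifier over [e] may move inside the
    almost sure statement. *)
Lemma ae_eps (Q : R -> Omega -> Prop) :
  (forall e e' w, 0 < e -> e <= e' -> Q e w -> Q e' w) ->
  (forall e, 0 < e -> {ae P, forall w, Q e w}) ->
  {ae P, forall w, forall e, 0 < e -> Q e w}.
Proof.
move=> mono h.
have inv0 n : 0 < n.+1%:R^-1 :> R by rewrite invr_gt0.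
apply: filterS (ae_foralln (fun n => h _ (inv0 n))) => w hw e e0.
apply: mono (hw (Num.truncn e^-1)) => //.
by rewrite -[leRHS]invrK lef_pV2 ?posrE ?invr_gt0// ltW// truncnS_gt.
Qed.

(** If slow growth had positive probability, it would be almost sure, and the stopping estimate
    would then force the integrals below [gam * n]. *)
Lemma kingman_lower (b : nat -> Omega -> R) (gam e : R) :
  {ae P, forall w, b 0%N w = 0} -> (forall n, intble P (b n)) -> subadd b ->
  (forall n, gam * n%:R <= \int[P]_w b n w) -> 0 < e ->
  {ae P, forall w, exists n0, forall n, (n0 <= n)%N -> (gam - e) * n%:R <= b n w}.
Proof.
move=> b0 bI bsub blow e0.
(* The additive constant k absorbs [b 1 w] and [gam - e], the cost of prepending one point to the
   orbit; this makes [F] semi-invariant. *)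
pose F := \bigcup_k \bigcap_n0 \bigcup_(n in [set n | (n0 <= n)%N])
  [set w | b n w <= (gam - e) * n%:R + k%:R].
have mF : measurable F.
  apply: bigcup_measurable => k _; apply: bigcap_measurableType => n0 _.
  by apply: bigcup_measurable => n _; apply: meas_le; exact: intble_meas.
have [PF|] := ae_not_or_pos mF; last first.
  apply: filterS => w nF; apply: contrapT => hn; apply: nF.
  exists 0%N => // n0 _; apply: contrapT => hn0; apply: hn; exists n0 => n n0n.
  rewrite leNgt; apply/negP => bn; apply: hn0; exists n => //=.
  by rewrite addr0 ltW.
have Fae : {ae P, forall w, F w}.
  apply: semi_invariant => //; apply: filterS bsub => w sub [k _ Fk].
  pose x := (Num.truncn `|b 1%N w|).+1; pose y := (Num.truncn `|gam - e|).+1.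
  exists (k + x + y)%N => // n0 _.
  have [n /= n0n bn] := Fk n0 I; exists n.+1 => /=; first exact: leqW.
  have := sub 1%N n; rewrite add1n /= => h.
  have : `|b 1%N w| < x%:R by exact: truncnS_gt.
  have : `|gam - e| < y%:R by exact: truncnS_gt.
  have := ler_norm (b 1%N w); have := ler_norm (- (gam - e)); rewrite normrN.
  by rewrite !natrD -(natr1 n) mulrDr mulr1; lra.
(* The mean of [b'] is at least [e / 2] per step, yet on [F] it is nonpositive at some
   [n > k / (e / 2)]. Stopping with [e / 4] is then a contradiction. *)
pose b' n w := b n w + (e / 2 - gam) * n%:R.
have b'I n : intble P (b' n) by apply: intbleD => //; exact: intble_cst.
have [] := @subadd_stopping b' (e / 4) _ b'I _ _ _.
- by apply: filterS b0 => w; rewrite /b' mulr0 addr0.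
- apply: filterS bsub => w sub m n; rewrite /b' natrD; have := sub m n; lra.
- apply: filterS Fae => w [k _ Fk].
  have [n /= hn bn] := Fk (Num.truncn (k%:R / (e / 2))).+1 I.
  exists n; first exact: leq_trans hn.
  have : k%:R / (e / 2) < n%:R.
    by apply: lt_le_trans (truncnS_gt _) _; rewrite ler_nat.
  rewrite ltr_pdivrMr /b'; last by lra.
  lra.
- lra.
move=> n n0; rewrite /b' RintegralD//; [|exact: bI|exact: intble_cst].
rewrite Ecst; have := blow n.
have : 0 < e * n%:R by rewrite mulr_gt0// ltr0n.
lra.
Qed.

(** Birkhoff sums of f and of -f are both subadditive, so the lower half of Kingman's theorem gives
    both bounds. *)
Lemma birkhoff_thm f : intble P f ->
  {ae P, forall w, forall e, 0 < e -> exists n0, forall n, (n0 <= n)%N ->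
    `|\sum_(i < n) f (iter i theta w) - (\int[P]_w f w) * n%:R| <= e * n%:R}.
Proof.
have half g : intble P g -> forall e, 0 < e ->
  {ae P, forall w, exists n0, forall n, (n0 <= n)%N ->
    ((\int[P]_w g w) - e) * n%:R <= \sum_(i < n) g (iter i theta w)}.
  move=> gI e e0.
  have hI : forall i, intble P (fun w => g (iter i theta w)) by move=> i; exact: intble_iter.
  apply: (@kingman_lower (fun n w => \sum_(i < n) g (iter i theta w))) => //.
  - by apply: aeW => w; rewrite big_ord0.
  - by move=> n; exact: (intble_sum n hI).
  - apply: aeW => w m n; rewrite big_split_ord /=.
    by apply: lerD; apply: ler_sum => i _ //=; rewrite -iterD addnC.
  - move=> n; rewrite (Esum n hI); under eq_bigr do rewrite E_iter//.
    rewrite (_ : \sum_(i < n) _ = \sum_(i < n) (\int[P]_w g w)); last by apply: eq_bigr.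
    by rewrite sumr_const card_ord mulr_natr.
move=> fI; apply: ae_eps => [e e' w e0 ee' [n0 h]|e e0].
  by exists n0 => n /h /le_trans; apply; rewrite ler_wpM2r.
have h1 := half _ fI _ e0; have h2 := half _ (intbleN fI) _ e0.
apply: filterS2 h1 h2 => w [n1 h1] [n2 h2]; exists (maxn n1 n2) => n.
rewrite geq_max => /andP[/h1 {}h1 /h2]; rewrite sumrN.
rewrite (_ : \int[P]_w - f w = - \int[P]_w f w); last first.
  under eq_Rintegral do rewrite -mulN1r.
  by rewrite RintegralZl// mulN1r.
by move=> {}h2; rewrite ler_norml; apply/andP; split; lra.
Qed.

(** The n-th term is the difference of two consecutive Birkhoff sums, whose linear parts cancel up
    to one copy of the mean. *)
Lemma orbit_sublinear f : intble P f ->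
  {ae P, forall w, forall e, 0 < e -> exists n0, forall n, (n0 <= n)%N ->
    `|f (iter n theta w)| <= e * n%:R}.
Proof.
move=> fI; apply: filterS (birkhoff_thm fI) => w h e e0.
have [n0 {}h] := h (e / 8) ltac:(lra).
set I := \int[P]_w f w in h.
exists (maxn n0 ((Num.truncn ((`|I| + e) / (e / 4))).+1)) => n; rewrite geq_max => /andP[n0n nI].
have : (`|I| + e) / (e / 4) < n%:R.
  by apply: lt_le_trans (truncnS_gt _) _; rewrite ler_nat.
rewrite ltr_pdivrMr; last by lra.
have := h n.+1 (leqW n0n); have := h n n0n.
rewrite big_ord_recr /= -(natr1 n).
rewrite !ler_norml => /andP[h1 h2] /andP[h3 h4].
have h5 := ler_norm I; have := ler_norm (- I); rewrite normrN => h6.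
by move=> h7; apply/andP; split; lra.
Qed.

(* The window sums U_n = b_n + ... + b_{n+k-1} telescope: U_{n+1} - U_n is at most
   b_k at time n, so Birkhoff's theorem is needed for theta only, not for theta^k. *)
Lemma kingman_upper (b : nat -> Omega -> R) (gam : R) (k : nat) : (0 < k)%N ->
  (forall n, intble P (b n)) -> subadd b -> \int[P]_w b k w <= gam * k%:R ->
  {ae P, forall w, forall e, 0 < e ->
     exists n0, forall n, (n0 <= n)%N -> b n w <= (gam + e) * n%:R}.
Proof.
move=> k0 bI bsub bk.
have h1 := birkhoff_thm (bI k); have h2 := orbit_sublinear (intble_abs (bI 1%N)).
apply: filterS3 h1 h2 (ae_orbit bsub) => w h1 h2 sub e e0.
have kR : 0 < k%:R :> R by rewrite ltr0n.
have iterate m n : b (m + n)%N w <= b m w + \sum_(i < n) `|b 1%N (iter (m + i) theta w)|.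
  elim: n => [|n IH]; first by rewrite addn0 big_ord0 addr0.
  rewrite addnS -addn1 big_ord_recr /=; apply: le_trans ((sub 0%N).1 _ _) _.
  by rewrite addrA; apply: lerD => //; exact: ler_norm.
pose U n := \sum_(j < k) b (n + j)%N w.
have hU n : U n <= U 0%N + \sum_(i < n) b k (iter i theta w).
  elim: n => [|n IH]; first by rewrite big_ord0 addr0.
  rewrite big_ord_recr /= addrA.
  suff : U n.+1 <= U n + b k (iter n theta w) by move: IH; lra.
  have UE : U n.+1 + b n w = U n + b (n + k)%N w.
    rewrite /U; case: k k0 {bk h1 kR U IH} => // k _.
    rewrite big_ord_recr [in RHS]big_ord_recl /= addn0 addnS addSn.
    rewrite (_ : \sum_(i < k) b (n.+1 + i)%N w = \sum_(i < k) b (n + bump 0 i)%N w); last first.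
      by apply: eq_bigr => i _; rewrite /bump /= add1n addSnnS.
    by lra.
  by have := (sub 0%N).1 n k => /=; lra.
set I := \int[P]_w b k w in bk h1.
(* Birkhoff's theorem contributes an error [dl] per step, and replacing the k window terms by b at
   time n + k contributes at most [k * k * dl]. This [dl] keeps the total below [k * (e / 4)]. *)
pose dl := e / (4 * (1 + k%:R)).
have dl0 : 0 < dl by rewrite divr_gt0// mulr_gt0// addr_gt0.
have [n1 {}h1] := h1 _ dl0; have [n2 {}h2] := h2 _ dl0.
have hn n : (n1 <= n)%N -> (n2 <= n)%N ->
    k%:R * b (n + k)%N w <= U 0%N + gam * k%:R * n%:R + dl * n%:R + k%:R * (k%:R * (dl * (n + k)%:R)).
  move=> hn1 hn2.
  (* From time n + j to n + k there are k - j increments [|b 1|], each at most [dl * (n + k)] by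
     sublinearity along the orbit. *)
  have : k%:R * b (n + k)%N w <= U n + k%:R * (k%:R * (dl * (n + k)%:R)).
    have -> : k%:R * b (n + k)%N w = \sum_(j < k) b (n + k)%N w.
      by rewrite sumr_const card_ord mulr_natl.
    have -> : k%:R * (k%:R * (dl * (n + k)%:R)) = \sum_(j < k) (k%:R * (dl * (n + k)%:R)).
      by rewrite sumr_const card_ord mulr_natl.
    rewrite /U -big_split; apply: ler_sum => j _ /=.
    have -> : (n + k = n + j + (k - j))%N by have := ltn_ord j; lia.
    apply: le_trans (iterate _ _) _; rewrite lerD2l.
    apply: (@le_trans _ _ (\sum_(i < k - j) (dl * (n + k)%:R))).
      apply: ler_sum => i _; apply: le_trans (ler_norm _) _.
      apply: le_trans (h2 _ _) _; first by rewrite -addnA; exact: leq_trans (leq_addr _ _).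
      rewrite ler_pM2l// ler_nat; have := ltn_ord j; have := ltn_ord i; lia.
    have -> : (n + j + (k - j) = n + k)%N by have := ltn_ord j; lia.
    rewrite sumr_const card_ord -[_ *+ _]mulr_natl ler_wpM2r//.
      by rewrite mulr_ge0// ltW.
    by rewrite ler_nat leq_subr.
  have := hU n; have := h1 n hn1; rewrite ler_norml => /andP[_].
  have : I * n%:R <= gam * k%:R * n%:R by rewrite ler_wpM2r.
  lra.
pose C := `|U 0%N| + `|gam * k%:R * k%:R|.
pose q := (Num.truncn (C / (e / 2))).+1.
have hq : C / (e / 2) < q%:R by exact: truncnS_gt.
move: q hq => q hq; exists (n1 + n2 + k + q)%N => N hN.
have -> : N = (N - k + k)%N by lia.
have {}hn := hn (N - k)%N ltac:(lia) ltac:(lia).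
have : q%:R <= (N - k + k)%:R :> R by rewrite ler_nat; lia.
set n := (N - k)%N in hn *.
move=> /(lt_le_trans hq) {hN hq}.
rewrite ltr_pdivrMr; last by lra.
set m := (n + k)%:R; have mE : n%:R = m - k%:R :> R by rewrite /m natrD addrK.
rewrite mE in hn; move: hn => hb hC.
rewrite -(ler_pM2l kR).
have m0 : 0 <= m by rewrite /m.
have d1 : dl * (1 + k%:R) = e / 4.
  by rewrite /dl; field; rewrite lt0r_neq0// addr_gt0.
have e1 : dl * m + k%:R * (k%:R * (dl * m)) <= k%:R * ((e / 4) * m).
  rewrite -d1.
  have k1 : 1 <= k%:R :> R by rewrite ler1n.
  have : 0 <= dl * m by rewrite mulr_ge0// ltW.
  set z := dl * m => z0.
  have -> : k%:R * (dl * (1 + k%:R) * m) = k%:R * z + k%:R * (k%:R * z).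
    by rewrite /z; ring.
  by rewrite lerD2r ler_peMl.
have := ler_norm (U 0%N); have := ler_norm (- (gam * k%:R * k%:R)); rewrite normrN.
have hC' : C <= k%:R * (m * (e / 2)).
  rewrite (le_trans (ltW hC))// ler_peMl ?ler1n// mulr_ge0//; lra.
have : 0 <= dl * k%:R by rewrite mulr_ge0// ltW.
have : 0 <= k%:R * (e / 4 * m) by rewrite !mulr_ge0//; lra.
move: hC' hb e1; rewrite /C => hC' hb e1 g1 g2 g3 g4.
have -> : k%:R * ((gam + e) * m) = gam * k%:R * m + k%:R * (m * (e / 2)) + k%:R * (m * (e/2)) by field.
have : k%:R * (m * (e / 2)) = k%:R * (e / 4 * m) + k%:R * (e / 4 * m) by field.
by move: hb; rewrite !mulrBr; lra.
Qed.

(** [gam] is the infimum of the normalised integrals. The first conclusion, exact for every n, is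
    what the critical value of s requires later. *)
Theorem kingman (b : nat -> Omega -> R) (C : R) :
  {ae P, forall w, b 0%N w = 0} -> (forall n, intble P (b n)) -> subadd b ->
  (forall n, C * n%:R <= \int[P]_w b n w) ->
  exists gam : R, (forall n, gam * n%:R <= \int[P]_w b n w) /\
    {ae P, forall w, forall e, 0 < e -> exists n0, forall n, (n0 <= n)%N ->
       `|b n w - gam * n%:R| <= e * n%:R}.
Proof.
move=> b0 bI bsub bC.
pose E n := (\int[P]_w b n.+1 w) / n.+1%:R.
have hE : has_inf (range E).
  split; first by exists (E 0%N); exists 0%N.
  by exists C => _ [n _ <-]; rewrite /E ler_pdivlMr ?ltr0n.
pose gam := inf (range E); exists gam.
have glow n : gam * n%:R <= \int[P]_w b n w.
  case: n => [|n]; last first.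
    by rewrite -ler_pdivlMr ?ltr0n//; apply: ge_inf; [exact: hE.2|exists n].
  by have := bC 0%N; rewrite !mulr0.
split => //; apply: ae_eps => [e e' w e0 ee' [n0 h]|e e0].
  by exists n0 => n /h /le_trans; apply; rewrite ler_wpM2r.
have e20 : 0 < e / 2 by lra.
have [_ [k _ <-] Ek] := inf_adherent e20 hE.
have hk : \int[P]_w b k.+1 w <= (gam + e / 2) * k.+1%:R.
  by rewrite -ler_pdivrMr ?ltr0n// ltW.
apply: filterS2 (kingman_lower b0 bI bsub glow e0) (kingman_upper (ltn0Sn k) bI bsub hk).
move=> w [n1 h1] h2; have [n2 {}h2] := h2 (e / 2) e20.
exists (maxn n1 n2) => n; rewrite geq_max => /andP[/h1 {}h1 /h2 {}h2].
by rewrite ler_norml; apply/andP; split; lra.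
Qed.

Lemma ae_and (Q Q' : Omega -> Prop) : {ae P, forall w, Q w} ->
  {ae P, forall w, Q' w} -> {ae P, forall w, Q w /\ Q' w}.
Proof. by apply: filterS2 => w; split. Qed.

Lemma ae_ex (Q : Omega -> Prop) : {ae P, forall w, Q w} -> exists w, Q w.
Proof.
move=> [A [mA PA sA]]; apply: contrapT => nQ.
have : A = setT by apply/seteqP; split => // w _; apply: sA => Qw; apply: nQ; exists w.
by move=> AT; move: PA; rewrite AT probability_setT => -[] /eqP; rewrite oner_eq0.
Qed.

(** Turns a constant that depends on the point into a single one valid on a set of positive
    measure. *)
Lemma pos_cover (G : set Omega) (A : nat -> set Omega) : measurable G -> (0 < P G)%E ->
  (forall n, measurable (A n)) -> {ae P, forall w, G w -> exists n, A n w} ->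
  exists n, (0 < P (A n))%E.
Proof.
move=> mG PG mA cov; apply: contrapT => hn.
have hA : {ae P, forall w, forall n, ~ A n w}.
  apply: ae_foralln => n; have [PA|//] := ae_not_or_pos (mA n).
  by exfalso; apply: hn; exists n.
have : P.-negligible G.
  have : {ae P, forall w, ~ G w}.
    by apply: filterS2 hA cov => w nA cw Gw; have [n] := cw Gw; exact: nA.
  by apply: negligibleS => w Gw /= nG; exact: nG Gw.
by move=> /(negligibleP P mG) PG0; rewrite PG0 ltxx in PG.
Qed.

Lemma intble_indic (A : set Omega) : measurable A -> intble P (\1_A : Omega -> R).
Proof.
move=> mA; apply: intble_le (intble_cst P 1) _; first exact: measurable_indic.
by apply: aeW => w; rewrite indicE; case: (_ \in _); rewrite ?normr1 ?normr0.
Qed.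

Lemma E_indic (A : set Omega) : measurable A -> (\int[P]_w (\1_A w : R)) = fine (P A).
Proof. by move=> mA; rewrite /Rintegral integral_indic// setIT. Qed.

(* If b were very negative at all large visits to G, the orbit could be cut at
   visits to a set K of positive measure into blocks of gain 1 each. *)
Lemma subadd_recurrent (b : nat -> Omega -> R) (G : set Omega) :
  {ae P, forall w, b 0%N w = 0} -> (forall n, intble P (b n)) -> subadd b ->
  measurable G -> (0 < P G)%E -> (forall n, 0 <= \int[P]_w b n w) ->
  {ae P, forall w, exists t : R, forall n0, exists n,
     [/\ (n0 <= n)%N, G (iter n theta w) & t <= b n w]}.
Proof.
move=> b0 bI bsub mG PG bge0.
have mGn n : measurable (iter n theta @^-1` G) by exact: preimage_meas (@iter_meas n) mG.
pose T c n0 := \bigcap_(n in [set n | (n0 <= n)%N])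
  (~` (iter n theta @^-1` G) `|` [set w | b n w <= c]).
have mT c n0 : measurable (T c n0).
  apply: bigcap_measurableType => n _; apply: measurableU; first exact: measurableC.
  by apply: meas_le; exact: intble_meas.
(* The event that b tends to -oo along the visits to [G], to be shown null. *)
pose F := \bigcap_(t : nat) \bigcup_n0 T (- t%:R) n0.
have mF : measurable F.
  by apply: bigcap_measurableType => t _; apply: bigcup_measurable.
have TP c n0 w : T c n0 w <-> forall n, (n0 <= n)%N -> G (iter n theta w) -> b n w <= c.
  split=> [h n nn0 Gn|h n /= nn0]; first by case: (h n nn0).
  by have [Gn|] := pselect (G (iter n theta w)); [right; exact: h|left].
have [PF|] := ae_not_or_pos mF; last first.
  apply: filterS => w nF; apply: contrapT => hn; apply: nF => t _.
  apply: contrapT => ht; apply: hn; exists (- t%:R) => n0; apply: contrapT => hn0.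
  apply: ht; exists n0 => //; apply/TP => n n0n Gn; rewrite leNgt; apply/negP => lt.
  by apply: hn0; exists n; rewrite ltW.
have Fae : {ae P, forall w, F w}.
  apply: semi_invariant => //; apply: filterS bsub => w sub Fw t _.
  have [n0 _ /TP h] := Fw (t + (Num.truncn `|b 1%N w|).+1)%N I.
  exists n0.+1 => //; apply/TP => -[//|n] n0n Gn.
  have := h n n0n; rewrite -iterSr => /(_ Gn).
  have := sub 1%N n; rewrite add1n /= natrD.
  have := ler_norm (b 1%N w); have := truncnS_gt `|b 1%N w|.
  by lra.
pose K n0 := G `&` T (- 1%:R) n0.
have mK n0 : measurable (K n0) by exact: measurableI.
have [m PK] : exists m, (0 < P (K m))%E.
  apply: (pos_cover mG PG mK); apply: filterS Fae => w Fw Gw.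
  by have [m _ Tw] := Fw 1%N I; exists m.
pose A := K m; have mA : measurable A by exact: mK.
have AP w : A w -> forall n, (m <= n)%N -> G (iter n theta w) -> b n w <= -1.
  by move=> [_ /TP].
pose S n w := \sum_(i < n) (\1_A (iter i theta w) : R).
have S1 n w : S n.+1 w <= S n w + 1.
  by rewrite /S big_ord_recr /= lerD2l indicE; case: (_ \in _).
have SI n : intble P (S n).
  by apply: (intble_sum n (h := fun i w => \1_A (iter i theta w))) => i; apply: intble_iter; exact: intble_indic.
(* Between two cuts b loses at least 1, while the orbit meets [A] at most m + 1 times. A charge [e]
   per visit with [e * M = 1/2] consumes only half of that gain. *)
pose M := m.+1%:R : R; have M0 : 0 < M by rewrite ltr0n.
pose e := (2 * M)^-1; have e0 : 0 < e by rewrite invr_gt0 mulr_gt0.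
have eM : e * M = 2^-1 by rewrite /e; field; rewrite lt0r_neq0.
have pA : 0 < fine (P A).
  by rewrite fine_gt0// PK /= ltey_eq fin_num_measure.
(* The charged cocycle has mean at least [e * P A] per step, so half of this rate is already
   contradictory. *)
have [] := @subadd_stopping (fun n w => b n w + e * S n w) (e * fine (P A) / 2) _ _ _ _ _.
- by apply: filterS b0 => w ->; rewrite /S big_ord0 mulr0 addr0.
- by move=> n; apply: intbleD => //; exact: intbleZ.
- apply: filterS bsub => w sub p q.
  have -> : S (p + q)%N w = S p w + S q (iter p theta w).
    rewrite /S big_split_ord /=; congr (_ + _).
    by apply: eq_bigr => i _; rewrite -[in RHS]iterD addnC.
  by have := sub p q; lra.
- apply: filterS2 (recurrence mA PK) (ae_orbit bsub) => w rec sub.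
  have [t0 t00 At0] := rec 1%N.
  have step k : exists n, [/\ (0 < n)%N, A (iter n theta w),
      b n w <= b t0 w - k%:R & S n w <= S t0 w + k%:R * M].
    elim: k => [|k [n [n0 An bn Sn]]].
      by exists t0; rewrite subr0 mul0r addr0.
    (* The next cut is the first visit to [A] after more than m steps: late enough for the bound -1,
       and no visit after the first m + 1 positions is skipped. *)
    pose Q j := `[< A (iter j (theta) (iter n theta w)) >] && (m < j)%N.
    have exQ : exists j, Q j.
      have [j nj Aj] := rec (n + m.+1)%N.
      exists (j - n)%N; rewrite /Q -iterD subnK; last by lia.
      by apply/andP; split; [exact/asboolP|lia].
    have [j /andP[/asboolP Aj mj] jmin] := ex_minnP exQ.
    exists (n + j)%N; split.
    - by rewrite addn_gt0 n0.
    - by rewrite addnC iterD.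
    - apply: le_trans ((sub 0%N).1 _ _) _ => /=.
      have : b j (iter n theta w) <= -1 by apply: AP => //; [exact: ltnW|exact: Aj.1].
      by rewrite -(natr1 k); lra.
    - have -> : S (n + j)%N w = S n w + S j (iter n theta w).
        rewrite /S big_split_ord /=; congr (_ + _).
        by apply: eq_bigr => i _; rewrite -[in RHS]iterD addnC.
      have : S j (iter n theta w) <= M.
        have Sle : forall i, S i (iter n theta w) <= i%:R.
          elim=> [|i IH]; first by rewrite /S big_ord0.
          by apply: le_trans (S1 _ _) _; rewrite -(natr1 i) lerD2r.
        have Sc : forall i, (m < i)%N -> (i <= j)%N -> S i (iter n theta w) <= M.
          elim=> [//|i IH] mi ij; have [mi'|im] := ltnP m i.
            have := IH mi' (ltnW ij); rewrite /S big_ord_recr /= indicE memNset ?addr0// => Ai.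
            have : (j <= i)%N by apply: jmin; rewrite /Q mi' andbT; exact/asboolP.
            by rewrite leqNgt ij.
          by apply: le_trans (Sle _) _; rewrite ler_nat.
        exact: Sc.
      by rewrite -(natr1 k) mulrDl mul1r; lra.
  pose D := b t0 w + e * S t0 w.
  have [n [n0 An bn Sn]] := step (Num.truncn (2 * `|D|)).+1.
  exists n => //.
  have := truncnS_gt (2 * `|D|); set k := _.+1%:R in bn Sn * => hk.
  have : e * S n w <= e * S t0 w + k / 2.
    have : e * S n w <= e * (S t0 w + k * M) by rewrite ler_pM2l.
    rewrite mulrDr (_ : e * (k * M) = k / 2) //.
    by rewrite mulrCA eM.
  by have := ler_norm D; rewrite /D; lra.
- by rewrite divr_gt0// mulr_gt0.
move=> n n0.
rewrite RintegralD//; [|exact: bI|exact: intbleZ].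
rewrite RintegralZl//; last exact: SI.
rewrite /S (Esum n (h := fun i w => \1_A (iter i theta w))); last first.
  by move=> i; apply: intble_iter; exact: intble_indic.
rewrite (_ : \sum_(i < n) _ = n%:R * fine (P A)); last first.
  under eq_bigr => i _ do rewrite (E_iter i (intble_indic mA)) E_indic//.
  by rewrite sumr_const card_ord mulr_natl.
have := bge0 n; have : 0 < e * (n%:R * fine (P A)) by rewrite !mulr_gt0// ltr0n.
by lra.
Qed.

(* For a nonmeasurable g the integral below is the supremum over simple functions
   below g; this is needed because M_w and m_w are extrema over uncountable sets. *)
Lemma le_lower_integral (f g : Omega -> \bar R) : measurable_fun setT f ->
  (forall w, (0 <= f w)%E) -> (forall w, (0 <= g w)%E) ->
  {ae P, forall w, (f w <= g w)%E} -> (\int[P]_w f w <= \int[P]_w g w)%E.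
Proof.
move=> mf f0 g0 [A [mA PA sA]].
(* Vanishing on the null set makes the domination hold everywhere, so each simple function below
   [f'] is below [g]. *)
pose f' w := if w \in A then 0%E else f w.
have mf' : measurable_fun setT f'.
  apply: measurable_fun_ifT => //; apply: (measurable_fun_bool true); rewrite setTI.
  rewrite (_ : _ @^-1` _ = A)//; apply/seteqP; split => w /=; first by move/set_mem.
  by move/mem_set.
have -> : (\int[P]_w f w = \int[P]_w f' w)%E.
  apply: ae_eq_integral => //; exists A; split => // w /= h; apply: contrapT => nA.
  by apply: h => _; rewrite /f' memNset.
have f'0 w : (0 <= f' w)%E by rewrite /f'; case: ifP.
rewrite !ge0_integralTE//; apply: le_ereal_sup => _ [h hf <-]; exists h => // w.
apply: le_trans (hf w) _; rewrite /f'; case: ifPn => // nA.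
by apply: contrapT => nle; move/negP: nA; apply; apply/mem_set/sA.
Qed.

(** As [g] may be nonmeasurable, the measurable minorant [F], equal to +oo on [A] and to [h]
    elsewhere, inherits its finite integral and yields both conclusions. *)
Lemma ae_finite_intble (A : set Omega) (h : Omega -> R) (g : Omega -> \bar R) :
  measurable A -> measurable_fun setT h -> (forall w, 0 <= h w) ->
  (forall w, (0 <= g w)%E) -> (\int[P]_w g w < +oo)%E ->
  {ae P, forall w, (A w -> g w = +oo%E) /\ ((h w)%:E <= g w)%E} ->
  {ae P, forall w, ~ A w} /\ intble P h.
Proof.
move=> mA mh h0 g0 gI hg.
pose F w := if w \in A then +oo%E else (h w)%:E.
have mF : measurable_fun setT F.
  apply: measurable_fun_ifT => //; last exact/measurable_EFinP.
  apply: (measurable_fun_bool true); rewrite setTI.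
  rewrite (_ : _ @^-1` _ = A)//; apply/seteqP; split => w /=; first by move/set_mem.
  by move/mem_set.
have F0 w : (0 <= F w)%E by rewrite /F; case: ifP; rewrite ?lee_fin.
have FI : (\int[P]_w F w < +oo)%E.
  apply: le_lt_trans gI; apply: le_lower_integral => //.
  by apply: filterS hg => w [gA gh]; rewrite /F; case: ifPn => // /set_mem /gA ->.
have Fint : P.-integrable setT F.
  by apply/integrableP; split => //; under eq_integral do rewrite gee0_abs//.
split.
  apply: filterS (integrable_ae measurableT Fint) => w /(_ I) + Aw.
  by rewrite /F mem_set.
apply/integrableP; split; first exact/measurable_EFinP.
apply: le_lt_trans FI; apply: ge0_le_integral => //.
- by apply/measurable_EFinP; apply: measurableT_comp.
- by move=> w _ /=; rewrite ger0_norm// /F; case: ifP => // _; rewrite leey.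
Qed.

End MeasurePreserving.

(** * Unordered sums *)

Section Esum.
Context (R : realType) (T : choiceType).
Implicit Types (I J : set T) (a b : T -> \bar R).
Local Open Scope ereal_scope.

Lemma esumZ_le (c : R) I a : (0 <= c)%R -> (forall i, 0 <= a i) ->
  \esum_(i in I) (c%:E * a i) <= c%:E * \esum_(i in I) a i.
Proof.
move=> c0 a0; apply: ub_ereal_sup => _ [F IF <-].
have [fF FI] := IF.
rewrite fsbig_finite//= -ge0_sume_distrr//.
apply: lee_wpmul2l => //.
by rewrite -(fsbig_finite _ _ fF)/=; apply: ereal_sup_ubound; exists F.
Qed.

Lemma esumZ (c : R) I a : (0 < c)%R -> (forall i, 0 <= a i) ->
  \esum_(i in I) (c%:E * a i) = c%:E * \esum_(i in I) a i.
Proof.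
move=> c0 a0; apply/eqP; rewrite eq_le (esumZ_le _ (ltW c0))//=.
have ca0 i : 0 <= c%:E * a i by rewrite mule_ge0// lee_fin ltW.
rewrite [in leLHS](eq_esum (b := fun i => (c^-1)%:E * (c%:E * a i))); last first.
  by move=> i _; rewrite muleA -EFinM mulVf ?gt_eqF// mul1e.
apply: (@le_trans _ _ (c%:E * ((c^-1)%:E * \esum_(i in I) (c%:E * a i)))).
  by apply: lee_wpmul2l; [rewrite lee_fin ltW|apply: esumZ_le => //; rewrite invr_ge0 ltW].
by rewrite muleA -EFinM mulfV ?gt_eqF// mul1e.
Qed.

Lemma esum_ge_term I a i : I i -> 0 <= a i -> a i <= \esum_(j in I) a j.
Proof.
move=> Ii ai; apply: esum_ge; exists [set i]; last by rewrite fsbig_set1.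
by split; [exact: finite_set1|move=> j ->].
Qed.

Lemma le_esum_cond I J a b : (forall i, J i -> 0 <= b i) ->
  (forall i, I i -> a i <= 0 \/ J i /\ a i <= b i) ->
  \esum_(i in I) a i <= \esum_(i in J) b i.
Proof.
move=> b0 h; rewrite (esum_mkcond I) (esum_mkcond J); apply: le_esum => i _.
case: ifPn => [/set_mem Ii|_].
  case: (h i Ii) => [ai0|[Ji aib]]; last by rewrite mem_set.
  apply: (le_trans ai0); case: ifPn => // /set_mem; exact: b0.
by case: ifPn => // /set_mem; exact: b0.
Qed.

End Esum.

(** Lets the length j of a common prefix grow until the distortion factor disappears. *)
Lemma le_expR_geometric (R : realType) (r B : R) (x y : \bar R) :
  0 < r < 1 -> (0 <= x)%E -> (0 <= y)%E ->
  (forall j, (0 < j)%N -> (x <= (expR (r ^+ j * B))%:E * y)%E) -> (x <= y)%E.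
Proof.
move=> /andP[r0 r1] x0 y0 h; case: y y0 h => [y| |]// y0 h; last by rewrite leey.
have := h 1%N isT; case: x x0 h => [x| |]// x0 h _; rewrite lee_fin.
have cv : (fun j => expR (r ^+ j * B) * y) j @[j --> \oo] --> y.
  rewrite -[X in _ --> X]mul1r -expR0 -(mul0r B); apply: cvgMl.
  apply: (@continuous_cvg _ _ _ _ _ _ expR); first exact: continuous_expR.
  by apply: cvgMl; apply: cvg_expr; rewrite ger0_norm// ltW.
apply: (cvgr_to_ge cv); near=> j.
have := h j; rewrite -EFinM lee_fin; apply; near: j; exact: nbhs_infty_gt.
Unshelve. all: by end_near. Qed.

(** * The Ruelle operator *)

Section Transfer.
Context (Omega : Type) (R : realType).
Variables (theta thinv : Omega -> Omega) (ell : Omega -> option nat)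
  (alpha : Omega -> nat -> nat -> bool) (phi : Omega -> (nat -> nat) -> R).
Hypotheses (th_can : cancel theta thinv) (thinv_can : cancel thinv theta).
Local Notation X := (inX theta ell alpha).
Local Notation RN := (RuelleN theta ell alpha phi).
Local Notation bk := (birkhoff theta phi).
Local Notation one := (fun _ : nat -> nat => 1%E : \bar R).
Implicit Types (w : Omega) (x y : nat -> nat) (f g : (nat -> nat) -> \bar R).

Lemma inX_shiftk k w x : X w x -> X (iter k theta w) (shiftk k x).
Proof. by move=> h i; rewrite -iterD /shiftk; exact: h. Qed.

Lemma inX_pre c w x :
  X w (pre c x) <-> [/\ ell_lt (ell w) c, alpha w c (x 0%N) & X (theta w) x].
Proof.
split=> [h|[h1 h2 h3] [|i]]; last 2 first.
- by [].
- by have := h3 i; rewrite -iterSr.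
by split; [exact: (h 0%N).1|exact: (h 0%N).2|move=> i; rewrite -iterSr; exact: (h i.+1)].
Qed.

Lemma shiftk_pre q y : pre (y q) (shiftk q.+1 y) = shiftk q y.
Proof. by apply/funext => -[|i] //=; rewrite /shiftk addnS. Qed.

Lemma Ruelle_le w f g x : (forall y, X w y -> (f y <= g y)%E) ->
  (Ruelle theta ell alpha phi w f x <= Ruelle theta ell alpha phi w g x)%E.
Proof.
move=> fg; apply: le_esum => c /= Xc.
by apply: lee_wpmul2l; [rewrite lee_fin expR_ge0|exact: fg].
Qed.

Lemma RuelleN_ge0 n w f x : (forall y, (0 <= f y)%E) -> (0 <= RN n w f x)%E.
Proof.
move=> f0; elim: n x => [|n IH] x //=; apply: esum_ge0 => c _.
by rewrite mule_ge0// lee_fin expR_ge0.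
Qed.

Lemma RuelleN_le n w f g x : (forall y, X w y -> (f y <= g y)%E) ->
  X (iter n theta w) x -> (RN n w f x <= RN n w g x)%E.
Proof.
move=> fg; elim: n x => [|n IH] x Xx /=; first exact: fg.
by apply: Ruelle_le => y; exact: IH.
Qed.

Lemma RuelleN_add m n w f : RN (m + n) w f = RN n (iter m theta w) (RN m w f).
Proof. by elim: n => [|n IH]; rewrite ?addn0// addnS /= IH -iterD addnC. Qed.

Lemma RuelleN_Z (c : R) n w f x : 0 < c -> (forall y, (0 <= f y)%E) ->
  RN n w (fun y => (c%:E * f y)%E) x = (c%:E * RN n w f x)%E.
Proof.
move=> c0 f0; elim: n x => [|n IH] x //=.
rewrite /Ruelle -esumZ//.
  by apply: eq_esum => b _; rewrite IH muleCA.
by move=> i; rewrite mule_ge0 ?RuelleN_ge0// lee_fin expR_ge0.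
Qed.

Lemma birkhoffS n w x : bk n.+1 w x = bk n w x + phi (iter n theta w) (shiftk n x).
Proof. by rewrite /birkhoff big_ord_recr. Qed.

Lemma RuelleN_ge_orbit q w f y : X w y -> (forall z, (0 <= f z)%E) ->
  ((expR (bk q w y))%:E * f y <= RN q w f (shiftk q y))%E.
Proof.
move=> Xy f0; elim: q => [|q IH] /=.
  rewrite /birkhoff big_ord0 expR0 mul1e (_ : shiftk 0 y = y)//.
  by apply/funext => i; rewrite /shiftk addn0.
rewrite birkhoffS addrC expRD EFinM -muleA.
apply: (@le_trans _ _ ((expR (phi (iter q theta w) (shiftk q y)))%:E
    * RN q w f (shiftk q y))%E).
  by apply: lee_wpmul2l => //; rewrite lee_fin expR_ge0.
rewrite -[in leLHS](shiftk_pre q y).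
apply: (@esum_ge_term _ _ [set c | X _ (pre c _)]
   (fun c => (expR (phi _ (pre c _)))%:E * RN q w f (pre c _))%E (y q)) => /=.
  by rewrite shiftk_pre; exact: inX_shiftk.
by rewrite mule_ge0 ?RuelleN_ge0// lee_fin expR_ge0.
Qed.

(** * Sums over words *)

Definition catx (v : seq nat) x : nat -> nat := foldr pre x v.

Lemma catx_lt v x i : (i < size v)%N -> catx v x i = nth 0%N v i.
Proof. by elim: v i => [|c v IH] [|i]//=; exact: IH. Qed.

Lemma shiftk_catx v x : shiftk (size v) (catx v x) = x.
Proof.
apply/funext => i; rewrite /shiftk; elim: v => [|c v IH] /=; first by rewrite addn0.
by rewrite addnS.
Qed.

Lemma inX_catx v w x : (0 < size v)%N -> admissible theta ell alpha w v ->
  X (iter (size v) theta w) x ->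
  alpha (iter (size v).-1 theta w) (nth 0%N v (size v).-1) (x 0%N) -> X w (catx v x).
Proof.
move=> v0 [adm1 adm2] Xx vx i; have [iv|vi] := ltnP i (size v); last first.
  have := shiftk_catx v x => /(congr1 (fun y => (y (i - size v)%N, y (i.+1 - size v)%N))).
  rewrite /shiftk !subnK//; last exact: leqW.
  move=> [-> ->]; rewrite subSn//; have := Xx (i - size v)%N.
  by rewrite -iterD subnK.
rewrite catx_lt//; split; first exact: adm1.
have [iv'|vi] := ltnP i.+1 (size v); first by rewrite catx_lt//; exact: adm2.
have iE : size v = i.+1 by lia.
have -> : catx v x i.+1 = x 0%N.
  have := shiftk_catx v x => /(congr1 (fun y => y 0%N)).
  by rewrite /shiftk add0n iE.
by move: vx; rewrite iE.
Qed.

Lemma RuelleN_words n w f x : (forall y, (0 <= f y)%E) -> X (iter n theta w) x ->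
  RN n w f x = (\esum_(v in [set v : seq nat | size v = n /\ X w (catx v x)])
      ((expR (bk n w (catx v x)))%:E * f (catx v x)))%E.
Proof.
move=> f0; have t0 n' y : (0 <= (expR (bk n' w y))%:E * f y)%E.
  by rewrite mule_ge0// lee_fin expR_ge0.
elim: n x => [|n IH] x Xx /=.
  rewrite (_ : [set v | _] = [set [::]]); last first.
    by apply/seteqP; split => v /= [] => [/size0nil|->].
  by rewrite esum_set1//= /birkhoff big_ord0 expR0 mul1e.
rewrite /Ruelle.
pose V c := [set v : seq nat | size v = n /\ X w (catx v (pre c x))].
rewrite (eq_esum (b := fun c => (\esum_(v in V c)
   ((expR (bk n.+1 w (catx (rcons v c) x)))%:E * f (catx (rcons v c) x)))%E)); last first.
  move=> c /= Xc; rewrite IH//.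
  rewrite -esumZ ?expR_gt0//.
  apply: eq_esum => v [sv _]; rewrite muleA -EFinM -expRD addrC birkhoffS.
  have -> : catx (rcons v c) x = catx v (pre c x) by rewrite /catx foldr_rcons.
  by have := shiftk_catx v (pre c x); rewrite sv => ->.
rewrite esum_esum; last by move=> c v _ _; exact: t0.
(* The outermost operator puts the last letter c in front of x, so a word of length n + 1 is read as
   a pair (c, v) standing for [rcons v c]. *)
symmetry; apply: (@reindex_esum R _ _ _ _ (fun p : nat * seq nat => rcons p.2 p.1)
  (fun v => (expR (bk n.+1 w (catx v x)))%:E * f (catx v x))%E).
split.
- move=> [c v] /= [Xc [sv Xv]]; split; first by rewrite size_rcons sv.
  by rewrite /catx foldr_rcons.
- move=> [c v] [c' v'] _ _ /= /eqP; rewrite eqseq_rcons.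
  by move=> /andP[/eqP -> /eqP ->].
- move=> v /= [sv Xv]; case/lastP: v sv Xv => [//|v c]; rewrite size_rcons => -[sv].
  rewrite {1}/catx foldr_rcons => Xv; exists (c, v) => //=; split => //=.
  by have := inX_shiftk n Xv; have := shiftk_catx v (pre c x); rewrite sv => ->.
Qed.

(** * Distortion *)

Variables (kap : Omega -> R) (r : R).
Hypothesis r01 : 0 < r < 1.

Definition agree (j : nat) x y := forall i, (i < j)%N -> x i = y i.

Definition holder_at w := forall j x y, (2 <= j)%N -> X w x -> X w y ->
  agree j x y -> `|phi w x - phi w y| <= kap w * r ^+ j.

(** Partial sums of the series for log B. *)
Definition SB n (w : Omega) : R := \sum_(i < n) kap (iter i.+1 thinv w) * r ^+ i.+1.

(* SB is the distortion sum seen from the end of the orbit segment, so its recursion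
   runs along theta. *)
Lemma SB_rec n w : SB n.+1 (theta w) = r * (kap w + SB n w).
Proof.
rewrite /SB big_ord_recl /= th_can expr1 mulrDr mulrC; congr (_ + _).
rewrite mulr_sumr; apply: eq_bigr => i _.
have E k : iter k.+1 thinv (theta w) = iter k thinv w by rewrite iterSr th_can.
by rewrite -[X in kap X * _]/(iter i.+2 thinv (theta w)) E /bump /= [r ^+ _.+1]exprS mulrCA.
Qed.

Lemma agree_shiftk n j x y : agree (n + j) x y -> agree j (shiftk n x) (shiftk n y).
Proof. by move=> h i ij; apply: h; rewrite addnC ltn_add2l. Qed.

(** Each of the n summands compares points that agree on at least j + 1 >= 2 letters, which is where
    the 2-Hölder condition begins. *)
Lemma birkhoff_distortion n w j x y : (forall k, holder_at (iter k theta w)) ->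
  (0 < j)%N -> X w x -> X w y -> agree (n + j) x y ->
  bk n w x <= bk n w y + r ^+ j * SB n (iter n theta w).
Proof.
move=> hw j0 Xx Xy; elim: n j j0 => [|n IH] j j0 a.
  by rewrite /birkhoff !big_ord0 /SB big_ord0 mulr0 addr0.
rewrite !birkhoffS /= SB_rec.
have a' : agree (n + j.+1) x y by rewrite addnS -addSn.
have := IH j.+1 isT a'; rewrite exprSr.
have := hw n j.+1 _ _ _ (inX_shiftk n Xx) (inX_shiftk n Xy) (agree_shiftk a').
rewrite ltnS j0 => /(_ isT); rewrite ler_norml exprSr => /andP[_].
by rewrite mulrA mulrDr; lra.
Qed.

Lemma agree_pre j c x y : agree j x y -> agree j.+1 (pre c x) (pre c y).
Proof. by move=> h [|i] //= ij; exact: h. Qed.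

(** Points with a common first letter have the same inverse branches, and each branch lengthens the
    common prefix by one, so the sums compare term by term. *)
Lemma RuelleN_distortion n w j x y : (forall k, holder_at (iter k theta w)) ->
  (0 < j)%N -> X (iter n theta w) x -> X (iter n theta w) y -> agree j x y ->
  (RN n w one x <= (expR (r ^+ j * SB n (iter n theta w)))%:E * RN n w one y)%E.
Proof.
move=> hw; elim: n j x y => [|n IH] j x y j0 Xx Xy a /=.
  by rewrite /SB big_ord0 mulr0 expR0 mul1e.
have t0 z : (0 <= (expR (phi (iter n theta w) z))%:E * RN n w one z)%E.
  by rewrite mule_ge0 ?RuelleN_ge0// lee_fin expR_ge0.
rewrite /Ruelle -esumZ ?expR_gt0//.
apply: le_esum_cond => [c _|c /= Xc].
  by rewrite mule_ge0// lee_fin expR_ge0.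
have Xc' : X (iter n theta w) (pre c y).
  by move/inX_pre : Xc => [h1 h2 h3]; apply/inX_pre; rewrite -(a 0%N).
right; split => //.
have := IH j.+1 _ _ isT Xc Xc' (agree_pre c a).
have := hw n j.+1 _ _ _ Xc Xc' (agree_pre c a).
rewrite ltnS j0 => /(_ isT); rewrite ler_norml => /andP[_ h1 h2].
apply: (@le_trans _ _ ((expR (phi (iter n theta w) (pre c y) + kap (iter n theta w) * r ^+ j.+1))%:E *
  ((expR (r ^+ j.+1 * SB n (iter n theta w)))%:E * RN n w one (pre c y)))%E).
  apply: lee_pmul h2; [by rewrite lee_fin expR_ge0|by apply: RuelleN_ge0|].
  by rewrite lee_fin ler_expR; lra.
rewrite !muleA -!EFinM -!expRD SB_rec.
rewrite [X in (expR X)%:E](_ : _ = r ^+ j * (r * (kap (iter n theta w) + SB n (iter n theta w)))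
  + phi (iter n theta w) (pre c y)) ?exprS//; ring.
Qed.

(** * The partition function *)

(** Any point of [va] agrees with [catx v xi] on n + 1 letters, so the supremum costs only a
    distortion factor with j = 1. *)
Lemma Zn_upper a n w xi : (0 < n)%N -> (forall k, holder_at (iter k theta w)) ->
  X (iter n theta w) xi -> xi 0%N = a ->
  (Zn theta ell alpha phi a n w <= (expR (r * SB n (iter n theta w)))%:E * RN n w one xi)%E.
Proof.
move=> n0 hw Xxi xia; rewrite RuelleN_words// -esumZ ?expR_gt0//.
apply: le_esum_cond => [v _|v [sv [[adm1 adm2] [va vla]]]].
  by rewrite mule1 -EFinM lee_fin mulr_ge0// expR_ge0.
have Xv : X w (catx v xi).
  by apply: inX_catx; rewrite ?sv// xia.
right; split => //; rewrite mule1 -EFinM -expRD.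
apply: ub_ereal_sup => _ [->|[x [Xx xv] <-]]; first by rewrite lee_fin expR_ge0.
rewrite lee_fin ler_expR addrC; have := @birkhoff_distortion n w 1 x (catx v xi) hw isT Xx Xv.
rewrite expr1; apply => i; rewrite addn1 ltnS => ni.
rewrite xv ?size_rcons ?sv// nth_rcons sv.
have [lt|ge] := ltnP i n; first by rewrite catx_lt// sv.
have -> : i = n by apply/eqP; rewrite eqn_leq ni.
rewrite eqxx -xia; have := shiftk_catx v xi => /(congr1 (fun y => y 0%N)).
by rewrite /shiftk add0n sv => ->.
Qed.

(** The words that carry weight on the left start at a and may return to it, and [catx v xi] is one
    of the points over which the supremum is taken. *)
Lemma Zn_lower a n w xi : (0 < n)%N -> X (iter n theta w) xi -> xi 0%N = a ->
  (RN n w (fun y => if y 0%N == a then 1 else 0) xi <= Zn theta ell alpha phi a n w)%E.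
Proof.
move=> n0 Xxi xia; rewrite RuelleN_words//; last by move=> y; case: ifP.
apply: le_esum_cond => [v _|v [sv Xv]].
  by apply: ereal_sup_ubound; left.
have [ya|_] := eqVneq (catx v xi 0%N) a; last by left; rewrite mule0.
have vxi : catx v xi n = a.
  have := shiftk_catx v xi => /(congr1 (fun y => y 0%N)).
  by rewrite /shiftk add0n sv => ->.
right; split.
  split => //; split; [split=> i iv|split].
  - by have := (Xv i).1; rewrite catx_lt.
  - by have := (Xv i).2; rewrite !catx_lt// ltnW.
  - by rewrite -ya catx_lt// sv.
  - by have := (Xv n.-1).2; rewrite prednK// vxi catx_lt // sv ltn_predL.
rewrite mule1; apply: ereal_sup_ubound; right; exists (catx v xi) => //.
split => // i; rewrite size_rcons sv ltnS => ni; rewrite nth_rcons sv.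
have [lt|ge] := ltnP i n; first by rewrite catx_lt// sv.
have -> : i = n by apply/eqP; rewrite eqn_leq ni.
by rewrite eqxx.
Qed.

(** * Big images and connecting words *)

Definition var1_le w (V : R) := forall x y, X w x -> X w y -> x 0%N = y 0%N ->
  `|phi w x - phi w y| <= V.

(** The last letter c of a word can be followed by some b in [I], so x is exchanged for [xb b]. The
    last step then sees only c in common, at cost [V]; the earlier steps cost the usual
    distortion. *)
Lemma big_image_bound n w (I : seq nat) (V : R) (xb : nat -> nat -> nat) x :
  (forall k, holder_at (iter k theta w)) -> var1_le (iter n theta w) V ->
  (forall c, ell_lt (ell (iter n theta w)) c ->
     exists2 b, b \in I & alpha (iter n theta w) c b) ->
  (forall b, b \in I -> X (iter n.+1 theta w) (xb b) /\ xb b 0%N = b) ->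
  X (iter n.+1 theta w) x ->
  (RN n.+1 w one x <= (expR (V + r * SB n (iter n theta w)))%:E
     * \sum_(b <- I) RN n.+1 w one (xb b))%E.
Proof.
move=> hw hV hI hxb Xx.
set C := expR _.
pose t c z := ((expR (phi (iter n theta w) (pre c z)))%:E * RN n w one (pre c z))%E.
have t0 c z : (0 <= t c z)%E by rewrite mule_ge0 ?RuelleN_ge0// lee_fin expR_ge0.
have C0 : 0 < C by exact: expR_gt0.
(* Summing over every b that may follow c avoids choosing one, and the sums over c and b can be
   exchanged. *)
pose u c b := if alpha (iter n theta w) c b then (C%:E * t c (xb b))%E else 0%E.
have u0 c b : (0 <= u c b)%E.
  by rewrite /u; case: ifP => // _; rewrite mule_ge0// lee_fin ltW.
pose Cx := [set c | X (iter n theta w) (pre c x)].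
apply: (@le_trans _ _ (\esum_(c in Cx) \sum_(b <- I) u c b)%E).
  apply: le_esum => c Xc; have [h1 h2 h3] := (inX_pre _ _ _).1 Xc.
  have [b bI cb] := hI c h1.
  apply: (@le_trans _ _ (u c b)); last first.
    rewrite (big_rem b)//= leeDl//.
    exact: sume_ge0.
  have [Xb xb0] := hxb b bI.
  have Xcb : X (iter n theta w) (pre c (xb b)) by apply/inX_pre; rewrite xb0.
  rewrite /u cb /C expRD EFinM.
  have a1 : agree 1 (pre c x) (pre c (xb b)) by move=> [].
  have := @RuelleN_distortion n w 1 _ _ hw isT Xc Xcb a1; rewrite expr1 => hd.
  have := hV _ _ Xc Xcb erefl; rewrite ler_norml => /andP[_ hv].
  rewrite /t muleACA -EFinM -expRD; apply: lee_pmul hd.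
  - by rewrite lee_fin expR_ge0.
  - exact: RuelleN_ge0.
  - by rewrite lee_fin ler_expR; lra.
rewrite esum_sum//.
rewrite ge0_sume_distrr; last by move=> b _; exact: RuelleN_ge0.
rewrite big_seq [leRHS]big_seq; apply: lee_sum => b bI.
rewrite /= /Ruelle -esumZ//; last by move=> c; exact: t0.
have [Xb xb0] := hxb b bI.
apply: le_esum_cond => [c _|c /= Xc]; first by apply: mule_ge0; [rewrite lee_fin ltW|exact: t0].
have [h1 h2 h3] := (inX_pre _ _ _).1 Xc.
rewrite /u; case: ifP => cb; last by left.
by right; split => //; apply/inX_pre; rewrite xb0.
Qed.

Lemma seq_bound (disp : Order.disp_t) (T : orderType disp) (t0 : T) (S : seq nat)
    (Q : nat -> T -> Prop) :
  (forall b D D', (D <= D')%O -> Q b D -> Q b D') ->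
  (forall b, b \in S -> exists D, Q b D) -> exists D, forall b, b \in S -> Q b D.
Proof.
move=> mono; elim: S => [|c S IH] h; first by exists t0.
have [D1 h1] := h c (mem_head _ _).
have [b bS|D2 h2] := IH; first by apply: h; rewrite inE bS orbT.
exists (Order.max D1 D2) => b; rewrite inE => /orP[/eqP ->|/h2].
  by apply: mono h1; rewrite le_max lexx.
by apply: mono; rewrite le_max lexx orbT.
Qed.

(** The first letter of x has a predecessor b' below [K], and b reaches b' in q steps. The cost of
    this word hardly depends on x, and only finitely many pairs (b, b') occur. *)
Lemma connecting_words q w (I : seq nat) (K : nat) (V : R) :
  (forall k, holder_at (iter k theta w)) -> var1_le (iter q theta w) V ->
  (forall c, ell_lt (ell (iter q.+1 theta w)) c -> exists b, [/\ (b < K)%N,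
     ell_lt (ell (iter q theta w)) b & alpha (iter q theta w) b c]) ->
  (forall b b', b \in I -> ell_lt (ell (iter q theta w)) b' -> (b' < K)%N ->
     exists z, [/\ X w z, z 0%N = b & z q = b']) ->
  exists D : R, forall b, b \in I -> forall x, X (iter q.+1 theta w) x ->
    exists y, [/\ X w y, y 0%N = b, shiftk q.+1 y = x & - D <= bk q.+1 w y].
Proof.
move=> hw hV hbp hz.
pose Q b b' (D : R) := forall x, X (iter q.+1 theta w) x ->
    alpha (iter q theta w) b' (x 0%N) ->
    exists y, [/\ X w y, y 0%N = b, shiftk q.+1 y = x & - D <= bk q.+1 w y].
have Qmono b b' D D' : D <= D' -> Q b b' D -> Q b b' D'.
  move=> DD' h x Xx bx; have [y [Xy y0 sy Dy]] := h x Xx bx.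
  by exists y; split => //; lra.
apply: (seq_bound (0 : R) (Q := fun b D => forall x, X (iter q.+1 theta w) x ->
    exists y, [/\ X w y, y 0%N = b, shiftk q.+1 y = x & - D <= bk q.+1 w y])).
  move=> b D D' DD' h x Xx; have [y [Xy y0 sy Dy]] := h x Xx.
  by exists y; split => //; lra.
move=> b bI.
have [b' b'S|D hD] := @seq_bound _ R 0 [seq b' <- iota 0 K | ell_lt (ell (iter q theta w)) b'] (Q b) (Qmono b).
  move: b'S; rewrite mem_filter mem_iota add0n => /and3P[lb' _ b'K].
  have [z [Xz z0 zq]] := hz b b' bI lb' b'K.
  (* The weight of the model point z, less the distortion of q steps and less [V] for the last step,
     where only the letter b' is shared. *)
  exists (- (bk q w z - r * SB q (iter q theta w) + phi (iter q theta w) (shiftk q z) - V)).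
  move=> x Xx b'x; pose v := mkseq z q.+1; pose y := catx v x.
  have sv : size v = q.+1 by rewrite size_mkseq.
  have yz : agree (q + 1) z y.
    by move=> i; rewrite addn1 => iq; rewrite /y catx_lt ?sv// nth_mkseq.
  have Xy : X w y.
    apply: inX_catx; rewrite ?sv//= ?nth_mkseq// ?zq//.
    split=> i; rewrite sv => iq; rewrite !nth_mkseq//; [exact: (Xz i).1|exact: (Xz i).2|].
    exact: ltnW.
  exists y; split => //.
  - by rewrite -sv shiftk_catx.
  - rewrite opprK birkhoffS.
    have := @birkhoff_distortion q w 1 z y hw isT Xz Xy yz; rewrite expr1.
    have := hV _ _ (inX_shiftk q Xz) (inX_shiftk q Xy).
    rewrite {1 2}/shiftk add0n => /(_ (yz q _)); rewrite addn1 ltnSn => /(_ isT); rewrite ler_norml => /andP[_].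
    lra.
exists D => x Xx; have [b' [b'K lb' b'x]] := hbp _ (Xx 0%N).1.
by apply: (hD b') => //; rewrite mem_filter lb' mem_iota.
Qed.

(** * Sections and extremal values of the iterates *)

Definition rows_at w := forall i, ell_lt (ell w) i ->
  exists j, ell_lt (ell (theta w)) j /\ alpha w i j.

Definition least w c : nat :=
  match pselect (exists j, ell_lt (ell (theta w)) j && alpha w c j) with
  | left h => ex_minn h
  | right _ => 0%N
  end.

Definition nxt w c p : nat :=
  if ell_lt (ell (theta w)) p && alpha w c p then p else least w c.

(* The point of X_w that follows the word v as long as v stays admissible and
   continues greedily afterwards. *)
Fixpoint sec (v : seq nat) w (i : nat) : nat :=
  match i with
  | 0 => if ell_lt (ell w) (nth 0%N v 0) then nth 0%N v 0 else 0%N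
  | i'.+1 => nxt (iter i' theta w) (sec v w i') (nth 0%N v i)
  end.

Hypothesis ell_gt1 : forall w, ell_lt (ell w) 1.

Lemma nxt_ok w c p : rows_at w -> ell_lt (ell w) c ->
  ell_lt (ell (theta w)) (nxt w c p) && alpha w c (nxt w c p).
Proof.
move=> hr hc; rewrite /nxt; case: ifP => [->//|_].
rewrite /least; case: pselect => [h|nh]; first by case: ex_minnP.
by exfalso; apply: nh; have [j [h1 h2]] := hr c hc; exists j; rewrite h1.
Qed.

Lemma sec_inX v w : (forall k, rows_at (iter k theta w)) -> X w (sec v w).
Proof.
move=> hr; have hl i : ell_lt (ell (iter i theta w)) (sec v w i).
  elim: i => [|i IH] /=; last by case/andP: (nxt_ok (nth 0%N v i.+1) (hr i) IH).
  case: ifP => // _; have := ell_gt1 w; rewrite /ell_lt; case: (ell w) => // n.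
  exact: ltnW.
by move=> i; split => //=; case/andP: (nxt_ok (nth 0%N v i.+1) (hr i) (hl i)).
Qed.

Lemma sec_agree x w j : X w x -> agree j x (sec (mkseq x j) w).
Proof.
move=> Xx; elim=> [|i IH] ij /=; first by rewrite nth_mkseq// (Xx 0%N).1.
rewrite nth_mkseq// /nxt -IH; last exact: ltnW.
by rewrite -iterS (Xx i.+1).1 (Xx i).2.
Qed.

Lemma sec_head b w : ell_lt (ell w) b -> sec [:: b] w 0%N = b.
Proof. by move=> /= ->. Qed.

Definition word (k : nat) : seq nat := odflt [::] (unpickle k).

Lemma word_pickle v : word (pickle v) = v.
Proof. by rewrite /word pickleK. Qed.

(** A supremum of countably many measurable functions; [lam_sup_ub] shows that it bounds all of X at
    regular points. *)
Definition lam_sup n w : \bar R :=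
  ereal_sup (range (fun k => RN n w one (sec (word k) (iter n theta w)))).

Definition lam_inf n w : \bar R :=
  ereal_inf (range (fun k => RN n w one (sec (word k) (iter n theta w)))).

Variable B : Omega -> R.

(** The almost sure properties required along a forward orbit. As [B] bounds all partial sums,
    distortion after any number of steps is controlled by the endpoint alone. *)
Record regular w : Prop := Regular {
  reg_rows : forall k, rows_at (iter k theta w);
  reg_holder : forall k, holder_at (iter k theta w);
  reg_B : forall k n, SB n (iter k theta w) <= B (iter k theta w);
  reg_sup : forall k, (lam_sup 1 (iter k theta w) < +oo)%E;
  reg_inf : forall k, (0 < lam_inf 1 (iter k theta w))%E }.

Lemma regular_iter k w : regular w -> regular (iter k theta w).
Proof. by case=> h1 h2 h3 h4 h5; split => m; rewrite -iterD. Qed.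

Lemma B_ge0 w : regular w -> 0 <= B w.
Proof. by move=> rw; have := reg_B rw 0 0; rewrite /SB big_ord0. Qed.

Lemma RN1_ge0 n w x : (0 <= RN n w one x)%E.
Proof. exact: RuelleN_ge0. Qed.
Hint Resolve RN1_ge0 : core.

Lemma RuelleN_distortionB n w j x y : regular w ->
  (0 < j)%N -> X (iter n theta w) x -> X (iter n theta w) y -> agree j x y ->
  (RN n w one x <= (expR (r ^+ j * B (iter n theta w)))%:E * RN n w one y)%E.
Proof.
move=> rw j0 Xx Xy a.
apply: le_trans (RuelleN_distortion (reg_holder rw) j0 Xx Xy a) _.
apply: lee_wpmul2r => //; rewrite lee_fin ler_expR ler_wpM2l ?reg_B//.
by rewrite exprn_ge0//; case/andP: r01 => /ltW.
Qed.

Lemma sec_regular v n w : regular w -> X (iter n theta w) (sec v (iter n theta w)).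
Proof. by move=> rw; apply: sec_inX => k; rewrite -iterD; exact: reg_rows. Qed.

Lemma lam_sup_ge0 n w : (0 <= lam_sup n w)%E.
Proof. by apply: le_trans (ereal_sup_ubound _); [exact: (RN1_ge0 n w (sec (word 0) (iter n theta w)))|exists 0%N]. Qed.

Lemma lam_inf_ge0 n w : (0 <= lam_inf n w)%E.
Proof. by apply/ereal_infP => _ [k _ <-]. Qed.

(** A section shares any prescribed prefix with x, at the price of a distortion factor tending to
    1. *)
Lemma lam_sup_ub n w x : regular w -> X (iter n theta w) x ->
  (RN n w one x <= lam_sup n w)%E.
Proof.
move=> rw Xx; apply: (le_expR_geometric (B := B (iter n theta w)) r01) => //.
  exact: lam_sup_ge0.
move=> j j0.
have a := sec_agree (j := j) Xx.
apply: (le_trans (RuelleN_distortionB rw j0 Xx (sec_regular (mkseq x j) n rw) a)).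
apply: lee_wpmul2l; first by rewrite lee_fin expR_ge0.
by apply: ereal_sup_ubound; exists (pickle (mkseq x j)); rewrite ?word_pickle.
Qed.

Lemma lam_inf_lb n w x : regular w -> X (iter n theta w) x ->
  (lam_inf n w <= RN n w one x)%E.
Proof.
move=> rw Xx; apply: (le_expR_geometric (B := B (iter n theta w)) r01) => //.
  exact: lam_inf_ge0.
move=> j j0.
have a : agree j (sec (mkseq x j) (iter n theta w)) x.
  by move=> i ij; rewrite -(sec_agree Xx ij).
apply: (@le_trans _ _ (RN n w one (sec (mkseq x j) (iter n theta w)))); last first.
  exact: (RuelleN_distortionB rw j0 (sec_regular (mkseq x j) n rw) Xx a).
by apply: ereal_inf_lbound; exists (pickle (mkseq x j)); rewrite ?word_pickle.
Qed.

Lemma lam_inf_le_sup n w : (lam_inf n w <= lam_sup n w)%E.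
Proof.
apply: (@le_trans _ _ (RN n w one (sec (word 0) (iter n theta w)))).
  by apply: ereal_inf_lbound; exists 0%N.
by apply: ereal_sup_ubound; exists 0%N.
Qed.

Lemma lam_supD m n w : regular w -> lam_sup m w \is a fin_num -> (0 < lam_sup m w)%E ->
  (lam_sup (m + n) w <= lam_sup m w * lam_sup n (iter m theta w))%E.
Proof.
move=> rw fin pos; apply: ub_ereal_sup => _ [k _ <-].
rewrite RuelleN_add; have Xs := sec_regular (word k) (m + n) rw.
have := fineK fin; set c := fine _ => cE; rewrite -cE.
have c0 : 0 < c by rewrite -lte_fin cE.
rewrite addnC iterD in Xs *.
apply: (@le_trans _ _ (RN n (iter m theta w) (fun y => (c%:E * one y)%E)
   (sec (word k) (iter n theta (iter m theta w))))).
  apply: RuelleN_le => // y Xy; rewrite mule1 cE; exact: lam_sup_ub.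
rewrite RuelleN_Z//; apply: lee_wpmul2l; first by rewrite lee_fin ltW.
by apply: lam_sup_ub => //; exact: regular_iter.
Qed.

Lemma lam_infD m n w : regular w -> lam_inf m w \is a fin_num -> (0 < lam_inf m w)%E ->
  (lam_inf m w * lam_inf n (iter m theta w) <= lam_inf (m + n) w)%E.
Proof.
move=> rw fin pos; apply/ereal_infP => _ [k _ <-].
rewrite RuelleN_add; have Xs := sec_regular (word k) (m + n) rw.
have := fineK fin; set c := fine _ => cE; rewrite -cE.
have c0 : 0 < c by rewrite -lte_fin cE.
rewrite addnC iterD in Xs *.
apply: (@le_trans _ _ (RN n (iter m theta w) (fun y => (c%:E * one y)%E)
   (sec (word k) (iter n theta (iter m theta w))))).
  rewrite RuelleN_Z//; apply: lee_wpmul2l; first by rewrite lee_fin ltW.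
  by apply: lam_inf_lb => //; exact: regular_iter.
by apply: RuelleN_le => // y Xy; rewrite mule1 cE; exact: lam_inf_lb.
Qed.

Lemma lam0 w : lam_sup 0 w = 1%E /\ lam_inf 0 w = 1%E.
Proof.
have E : range (fun k => RN 0 w one (sec (word k) (iter 0 theta w))) = [set 1%E].
  by apply/seteqP; split => [_ [k _ <-]//|_ ->]; exists 0%N.
by rewrite /lam_sup /lam_inf E ereal_sup1 ereal_inf1.
Qed.

Lemma lam_bounds n w : regular w ->
  [/\ (0 < lam_inf n w)%E, (lam_sup n w < +oo)%E, lam_inf n w \is a fin_num &
      lam_sup n w \is a fin_num].
Proof.
move=> rw.
have fin m : (0 < lam_inf m w)%E -> (lam_sup m w < +oo)%E ->
    lam_inf m w \is a fin_num /\ lam_sup m w \is a fin_num.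
  move=> h1 h2; rewrite !ge0_fin_numE ?lam_inf_ge0 ?lam_sup_ge0//; split => //.
  exact: le_lt_trans (lam_inf_le_sup m w) h2.
suff [h1 h2] : (0 < lam_inf n w)%E /\ (lam_sup n w < +oo)%E by have [] := fin n h1 h2.
elim: n => [|n [IH1 IH2]]; first by have [-> ->] := lam0 w; rewrite lte_fin ltr01 ltry.
have [f1 f2] := fin n IH1 IH2.
have p2 : (0 < lam_sup n w)%E by exact: lt_le_trans IH1 (lam_inf_le_sup _ _).
rewrite -addn1; split.
  apply: lt_le_trans (lam_infD 1 rw f1 IH1).
  by rewrite mule_gt0// reg_inf.
apply: le_lt_trans (lam_supD 1 rw f2 p2) _.
have s1 : lam_sup 1 (iter n theta w) \is a fin_num.
  by rewrite ge0_fin_numE ?lam_sup_ge0// reg_sup.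
by rewrite -ge0_fin_numE ?fin_numM// mule_ge0 ?lam_sup_ge0.
Qed.

(** [V], [D], both values of [B] and the infimum over the last s steps belong to eta and its
    neighbours, so k depends neither on n nor on w. The s additional steps leave room to reach a
    prescribed set. *)
Lemma compare_sup_inf eta (I : seq nat) (V D : R) (q s : nat) : regular (thinv eta) ->
  var1_le (thinv eta) V ->
  (forall c, ell_lt (ell (thinv eta)) c -> exists2 b, b \in I & alpha (thinv eta) c b) ->
  (forall b, b \in I -> ell_lt (ell eta) b) ->
  (forall b, b \in I -> forall x, X (iter q theta eta) x ->
    exists y, [/\ X eta y, y 0%N = b, shiftk q y = x & - D <= bk q eta y]) ->
  exists k : nat, forall n w, regular w -> iter n.+1 theta w = eta ->
    (lam_sup n.+1 w <= k%:R%:E * lam_inf (n.+1 + (q + s)) w)%E.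
Proof.
move=> rth hV hI hIl hD.
have reta : regular eta by rewrite -(thinv_can eta) -[theta _]/(iter 1 theta _); exact: regular_iter.
have [l0 _ lf _] := lam_bounds s (regular_iter q reta).
have := fineK lf; set c := fine _ => cE.
have c0 : 0 < c by rewrite -lte_fin cE.
pose C1 := expR (V + r * B (thinv eta)).
pose C2 := expR (D + r * B eta).
pose C := C1 * ((size I)%:R * C2) * c^-1.
exists (Num.truncn C).+1 => n w rw wE.
have wE' : iter n theta w = thinv eta by rewrite -wE iterS th_can.
pose xb b := sec [:: b] eta.
have hxb b : b \in I -> X (iter n.+1 theta w) (xb b) /\ xb b 0%N = b.
  move=> bI; rewrite wE; split; last exact: sec_head (hIl b bI).
  exact: (sec_regular [:: b] 0 reta).
set L := lam_inf (n.+1 + q) w.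
have [L0 _ Lf _] := lam_bounds (n.+1 + q) rw.
(* Every target point is reached from some y with first letter b at weight at least [exp(- D)], and
   y may replace [xb b] up to [exp(r * B eta)]. *)
have bound b : b \in I -> (RN n.+1 w one (xb b) <= C2%:E * L)%E.
  move=> bI; have [Xb xb0] := hxb b bI.
  have : ((C2^-1)%:E * RN n.+1 w one (xb b) <= L)%E.
    apply/ereal_infP => _ [k _ <-]; rewrite RuelleN_add wE.
    have Xs := sec_regular (word k) q reta.
    have -> : iter (n.+1 + q) theta w = iter q theta eta by rewrite addnC iterD wE.
    have [y [Xy y0 <- Dy]] := hD b bI _ Xs.
    apply: le_trans (RuelleN_ge_orbit q Xy (fun z => RN1_ge0 n.+1 w z)).
    rewrite -wE in Xy.
    have a1 : agree 1 (xb b) y by move=> [|//] _; rewrite xb0 y0.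
    have hd := RuelleN_distortionB rw (ltn0Sn 0) Xb Xy a1.
    rewrite wE expr1 in hd.
    apply: (@le_trans _ _ ((C2^-1)%:E * ((expR (r * B eta))%:E * RN n.+1 w one y))%E).
      by apply: lee_wpmul2l => //; rewrite lee_fin invr_ge0 expR_ge0.
    rewrite muleA -EFinM; apply: lee_wpmul2r => //.
    by rewrite lee_fin -expRN -expRD ler_expR; lra.
  move=> h; have : (C2%:E * ((C2^-1)%:E * RN n.+1 w one (xb b)) <= C2%:E * L)%E.
    by apply: lee_wpmul2l => //; rewrite lee_fin expR_ge0.
  by rewrite muleA -EFinM mulfV ?gt_eqF ?expR_gt0// mul1e.
have hsup : (lam_sup n.+1 w <= C1%:E * ((size I)%:R%:E * (C2%:E * L)))%E.
  apply: ub_ereal_sup => _ [k _ <-].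
  have Xs := sec_regular (word k) n.+1 rw.
  have hw' := reg_holder rw.
  have := @big_image_bound n w I V xb _ hw' _ _ hxb Xs; rewrite wE' => /(_ hV hI) /le_trans; apply.
  apply: lee_pmul.
  - by rewrite lee_fin expR_ge0.
  - by apply: sume_ge0 => b _; exact: RN1_ge0.
  - rewrite lee_fin ler_expR lerD2l ler_wpM2l//; first by case/andP: r01 => /ltW.
    exact: (reg_B rth 0 n).
  - move: (I) bound; elim=> [|b S IH] bnd; first by rewrite big_nil mul0e.
    rewrite big_cons /= -natr1 [_%:R + 1]addrC EFinD ge0_muleDl ?lee_fin//.
    rewrite mul1e; apply: leeD; first by apply: bnd; rewrite mem_head.
    by apply: IH => b' b'S; apply: bnd; rewrite inE b'S orbT.
apply: (le_trans hsup).
have hinf : (L * c%:E <= lam_inf (n.+1 + (q + s)) w)%E.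
  rewrite cE addnA; have -> : iter q theta eta = iter (n.+1 + q) theta w.
    by rewrite [in RHS]addnC iterD wE.
  exact: lam_infD.
apply: (@le_trans _ _ (C%:E * (L * c%:E))%E).
  have -> : L = (fine L)%:E by rewrite fineK.
  rewrite -!EFinM lee_fin /C le_eqVlt; apply/orP; left; apply/eqP.
  by field; rewrite gt_eqF.
apply: lee_pmul hinf.
- by rewrite lee_fin !mulr_ge0 ?expR_ge0// invr_ge0 ltW.
- by rewrite mule_ge0// ?lam_inf_ge0// lee_fin ltW.
- by rewrite lee_fin ltW// truncnS_gt.
Qed.

End Transfer.

(** * Measurability *)

Section Measurability.
Context (d : measure_display) (Omega : measurableType d) (R : realType).
Variables (theta : Omega -> Omega) (ell : Omega -> option nat)
  (alpha : Omega -> nat -> nat -> bool) (phi : Omega -> (nat -> nat) -> R).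
Hypotheses (th_meas : measurable_fun setT theta)
  (ell_meas : forall o : option nat, measurable [set w | ell w = o])
  (alpha_meas : forall i j : nat, measurable [set w | alpha w i j])
  (phi_meas : measurable_potential theta ell alpha phi).
Local Notation X := (inX theta ell alpha).
Local Notation RN := (RuelleN theta ell alpha phi).
Local Notation one := (fun _ : nat -> nat => 1%E : \bar R).

Definition msec (s : Omega -> nat -> nat) := forall i k, measurable [set w | s w i = k].

Lemma mset_and (A B : Omega -> Prop) : measurable [set w | A w] ->
  measurable [set w | B w] -> measurable [set w | A w /\ B w].
Proof. exact: measurableI. Qed.

Lemma mset_or (A B : Omega -> Prop) : measurable [set w | A w] ->
  measurable [set w | B w] -> measurable [set w | A w \/ B w].
Proof. exact: measurableU. Qed.

Lemma mset_not (A : Omega -> Prop) : measurable [set w | A w] ->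
  measurable [set w | ~ A w].
Proof. exact: measurableC. Qed.

Lemma mset_all (A : nat -> Omega -> Prop) : (forall n, measurable [set w | A n w]) ->
  measurable [set w | forall n, A n w].
Proof.
move=> h; rewrite (_ : [set w | _] = \bigcap_n [set w | A n w]).
  exact: bigcap_measurableType.
by apply/seteqP; split => w hw n; [move=> _; exact: hw|exact: (hw n I)].
Qed.

Lemma mset_ex (A : nat -> Omega -> Prop) : (forall n, measurable [set w | A n w]) ->
  measurable [set w | exists n, A n w].
Proof.
move=> h; rewrite (_ : [set w | _] = \bigcup_n [set w | A n w]).
  exact: bigcup_measurable.
by apply/seteqP; split => w [n]; [exists n|exists n].
Qed.

Lemma mset_const (A : Prop) : measurable [set w : Omega | A].
Proof.
have [a|a] := pselect A.
  by rewrite (_ : mkset _ = setT) //; apply/seteqP; split => w.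
by rewrite (_ : mkset _ = set0) //; apply/seteqP; split => w.
Qed.

Lemma mset_imp (A B : Omega -> Prop) : measurable [set w | A w] ->
  measurable [set w | B w] -> measurable [set w | A w -> B w].
Proof.
move=> mA mB; rewrite (_ : [set w | _] = [set w | ~ A w \/ B w]).
  by apply: mset_or => //; exact: mset_not.
apply/seteqP; split=> w /=; last by case.
by move=> h; have [Aw|] := pselect (A w); [right; exact: h|left].
Qed.

Lemma mset_dep (f : Omega -> nat) (Q : Omega -> nat -> Prop) :
  (forall k, measurable [set w | f w = k]) ->
  (forall k, measurable [set w | Q w k]) -> measurable [set w | Q w (f w)].
Proof.
move=> mf mQ; rewrite (_ : [set w | _] = [set w | exists k, f w = k /\ Q w k]).
  by apply: mset_ex => k; exact: mset_and.
by apply/seteqP; split => w /=; [move=> ?; exists (f w)|move=> [k [<-]]].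
Qed.

Lemma mset_iter (A : Omega -> Prop) n : measurable [set w | A w] ->
  measurable [set w | A (iter n theta w)].
Proof. exact: (preimage_meas (iter_meas th_meas n)). Qed.

Lemma mset_theta (A : Omega -> Prop) : measurable [set w | A w] ->
  measurable [set w | A (theta w)].
Proof. exact: (@mset_iter A 1). Qed.

Lemma mset_ell c : measurable [set w | ell_lt (ell w) c].
Proof.
rewrite (_ : [set w | _] = [set w | ell w = None \/
   exists n, ell w = Some n /\ (c < n)%N]).
  apply: mset_or; first exact: ell_meas.
  by apply: mset_ex => n; apply: mset_and; [exact: ell_meas|exact: mset_const].
apply/seteqP; split => w /=; rewrite /ell_lt; case: (ell w) => [n|].
- by move=> h; right; exists n.
- by left.
- by move=> [//|[m [[->]]]].
- by [].
Qed.

Lemma mset_inX s : msec s -> measurable [set w | X w (s w)].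
Proof.
move=> ms; apply: mset_all => i; apply: mset_and.
  apply: (mset_dep (Q := fun w k => ell_lt (ell (iter i theta w)) k)) => // k.
  exact: (mset_iter (A := fun w => ell_lt (ell w) k)) (mset_ell k).
apply: (mset_dep (Q := fun w k => alpha (iter i theta w) k (s w i.+1))) => // k.
apply: (mset_dep (Q := fun w l => alpha (iter i theta w) k l)) => // l.
exact: (mset_iter (A := fun w => alpha w k l)).
Qed.

Lemma msec_pre c s : msec s -> msec (fun w => pre c (s (theta w))).
Proof.
move=> ms [|i] k /=; first exact: mset_const.
exact: (mset_theta (A := fun w => s w i = k)).
Qed.

Lemma msec_sec v : msec (sec theta ell alpha v).
Proof.
have mok c j : measurable [set w | ell_lt (ell (theta w)) j && alpha w c j].
  rewrite (_ : [set w | _] = [set w | ell_lt (ell (theta w)) j /\ alpha w c j]).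
    apply: mset_and => //.
    exact: (mset_theta (A := fun w => ell_lt (ell w) j)) (mset_ell j).
  by apply/seteqP; split => w /= /andP.
have mleast c k : measurable [set w | least theta ell alpha w c = k].
  pose ok w j := ell_lt (ell (theta w)) j && alpha w c j.
  rewrite (_ : [set w | _] = [set w |
    (ok w k /\ forall j, (j < k)%N -> ~ ok w j) \/ (k = 0%N /\ forall j, ~ ok w j)]).
    apply: mset_or; apply: mset_and => //.
    - exact: mok.
    - by apply: mset_all => j; apply: mset_imp; [exact: mset_const|apply: mset_not; exact: mok].
    - exact: mset_const.
    - by apply: mset_all => j; apply: mset_not; exact: mok.
  apply/seteqP; split => w /=; rewrite /least; case: pselect => [h|nh].
  - case: ex_minnP => m okm mmin <-; left; split=> // j jm okj.
    by have := mmin j okj; rewrite leqNgt jm.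
  - by move=> <-; right; split => // j okj; apply: nh; exists j.
  - case: ex_minnP => m okm mmin [[okk hk]|[_ /(_ _ okm)//]].
    apply/eqP; rewrite eqn_leq mmin//= leqNgt; apply/negP => mk.
    exact: hk okm.
  - by move=> [[okk _]|[->//]]; exfalso; apply: nh; exists k.
have mnxt c p k : measurable [set w | nxt theta ell alpha w c p = k].
  pose ok w := ell_lt (ell (theta w)) p && alpha w c p.
  rewrite (_ : [set w | _] = [set w |
    (ok w /\ p = k) \/ (~ ok w /\ least theta ell alpha w c = k)]).
    apply: mset_or; apply: mset_and => //; [exact: mok|exact: mset_const|].
    by apply: mset_not; exact: mok.
  apply/seteqP; split => w /=; rewrite /nxt /ok; case: ifP.
  - by left.
  - by move=> h e; right; split => //; rewrite h.
  - by move=> h [[]|[/(_ isT)]].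
  - by move=> h [[]|[_]].
elim=> [|i IH] k /=.
  rewrite (_ : [set w | _] = [set w | (ell_lt (ell w) (nth 0%N v 0) /\ nth 0%N v 0 = k) \/
     (~ ell_lt (ell w) (nth 0%N v 0) /\ 0%N = k)]).
    apply: mset_or; apply: mset_and; try exact: mset_const; first exact: mset_ell.
    exact: mset_not (mset_ell _).
  apply/seteqP; split => w /=; case: ifP.
  - by left.
  - by move=> h e; right; split => //; rewrite h.
  - by move=> h [[]|[/(_ isT)]].
  - by move=> h [[]|[_]].
apply: (mset_dep (Q := fun w c => nxt theta ell alpha (iter i theta w) c (nth 0%N v i.+1) = k)) => // c.
exact: (mset_iter (A := fun w => nxt theta ell alpha w c (nth 0%N v i.+1) = k)).
Qed.

(** Sets whose pullback along w -> (w, s w) is measurable form a sigma-algebra on X that contains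
    the generators. *)
Lemma trace_meas s (E : set (Omega * (nat -> nat))) : msec s ->
  let D := Xset theta ell alpha in
  <<s D, [set E | exists (A : set Omega) (v : seq nat),
            measurable A /\ E = D `&` (A `*` cylN v)] >> E ->
  measurable [set w | X w (s w) /\ E (w, s w)].
Proof.
move=> ms D.
apply: (smallest_sub (X := [set E | measurable [set w | X w (s w) /\ E (w, s w)]])).
- split.
  + rewrite /= (_ : [set w | _] = set0)//; by apply/seteqP; split => w // [].
  + move=> F /= mF.
    rewrite (_ : [set w | _] = [set w | X w (s w) /\ ~ (X w (s w) /\ F (w, s w))]).
      by apply: mset_and; [exact: mset_inX|exact: mset_not].
    apply/seteqP; split => w [Xw h]; split => //.
      by move=> [_ Fw]; exact: h.2.
    by split => // Fw; apply: h.
  + move=> F mF /=.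
    rewrite (_ : [set w | _] = [set w | exists n, X w (s w) /\ F n (w, s w)]).
      by apply: mset_ex => n; exact: mF.
    apply/seteqP; split => w /=; first by move=> [Xw [n _ Fn]]; exists n.
    by move=> [n [Xw Fn]]; split => //; exists n.
- move=> F /= [A [v [mA ->]]].
  rewrite (_ : [set w | _] = [set w | X w (s w) /\ (A w /\
     forall i, (i < size v)%N -> s w i = nth 0%N v i)]).
    apply: mset_and; first exact: mset_inX.
    apply: mset_and => //; apply: mset_all => i.
    by apply: mset_imp; [exact: mset_const|exact: ms].
  by apply/seteqP; split => w /= [Xw]; [move=> [_ [Aw h]]|move=> [Aw h]].
Qed.

(** The value 0 is a default off X, where nothing is known about [phi]. *)
Lemma meas_phi s : msec s ->
  measurable_fun setT (fun w => if `[< X w (s w) >] then phi w (s w) else 0).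
Proof.
move=> ms _ Y mY; rewrite setTI.
rewrite (_ : _ @^-1` _ = [set w | (X w (s w) /\ (Xset theta ell alpha `&`
   [set p | Y (phi p.1 p.2)]) (w, s w)) \/ (~ X w (s w) /\ Y 0)]).
  apply: mset_or.
    exact: (trace_meas ms (phi_meas mY)).
  by apply: mset_and; [exact: mset_not (mset_inX ms)|exact: mset_const].
apply/seteqP; split => w /=; case: asboolP => Xw.
- by move=> Yw; left.
- by right.
- by move=> [[_ []]|[]].
- by move=> [[]|[]].
Qed.

(** The induction quantifies over all measurable families, because each inverse branch of a family
    is again one. *)
Lemma meas_RuelleN n s : msec s ->
  measurable_fun setT (fun w => RN n w one (s (iter n theta w))).
Proof.
elim: n s => [|n IH] s ms /=; first exact: measurable_cst.
pose sc c w := pre c (s (theta w)).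
pose t c w := ((if `[< X w (sc c w) >] then expR (if `[< X w (sc c w) >] then phi w (sc c w) else 0)
  else 0)%:E).
pose u c w := (t c (iter n theta w) * RN n w one (sc c (iter n theta w)))%E.
have u0 c w : (0 <= u c w)%E.
  rewrite mule_ge0 ?RuelleN_ge0// lee_fin; case: ifP => // _; exact: expR_ge0.
rewrite (_ : (fun w => _) = (fun w => \sum_(0 <= c <oo | c \in predT) u c w)%E).
  apply: ge0_emeasurable_sum => // c _.
  apply: emeasurable_funM; last by apply: IH; exact: msec_pre.
  apply: (measurableT_comp (f := t c) _ (iter_meas th_meas n)).
  apply/measurable_EFinP; apply: measurable_fun_ifT => //.
    apply: (measurable_fun_bool true); rewrite setTI.
    rewrite (_ : _ @^-1` _ = [set w | X w (sc c w)]); first exact: mset_inX (msec_pre _ _).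
    by apply/seteqP; split => w /= /asboolP.
  by apply: measurableT_comp => //; apply: meas_phi; exact: msec_pre.
apply/funext => w; rewrite nneseries_esumT; last by move=> c; exact: u0.
rewrite /Ruelle esum_mkcond; apply: eq_esum => c _.
rewrite /u /t /sc -iterS; case: asboolP => Xc; first by rewrite mem_set.
by rewrite memNset// mul0e.
Qed.

Lemma meas_lam_sup n : measurable_fun setT (lam_sup theta ell alpha phi n).
Proof.
have := @measurable_fun_esups _ _ _ setT
  (fun k w => RN n w one (sec theta ell alpha (word k) (iter n theta w)))
  (fun k => meas_RuelleN n (msec_sec (word k))) 0.
congr (measurable_fun _ _); apply/funext => w; congr ereal_sup.
by apply/seteqP; split => _ [k _ <-]; exists k.
Qed.

Lemma meas_lam_inf n : measurable_fun setT (lam_inf theta ell alpha phi n).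
Proof.
have := @measurable_fun_einfs _ _ _ setT
  (fun k w => RN n w one (sec theta ell alpha (word k) (iter n theta w)))
  (fun k => meas_RuelleN n (msec_sec (word k))) 0.
congr (measurable_fun _ _); apply/funext => w; congr ereal_inf.
by apply/seteqP; split => _ [k _ <-]; exists k.
Qed.

End Measurability.

Lemma elog_le (R : realType) (x y : \bar R) : (x <= y)%E -> (elog x <= elog y)%E.
Proof.
case: x => [x| |]; case: y => [y| |] //=; rewrite ?leey ?leNye//.
rewrite lee_fin => xy; case: ifPn => x0; last by rewrite leNye.
by rewrite (lt_le_trans x0 xy) lee_fin ler_ln ?posrE// (lt_le_trans x0 xy).
Qed.

Lemma elog_fin (R : realType) (x : R) : 0 < x -> elog x%:E = (ln x)%:E.
Proof. by move=> x0; rewrite /= x0. Qed.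

Lemma fine_logB (Omega : Type) (R : realType) (thinv : Omega -> Omega)
    (kap : Omega -> R) (r : R) n w : 0 < r -> (forall w, 1 <= kap w) ->
  (logB thinv kap r w < +oo)%E ->
  SB thinv kap r n w <= fine (logB thinv kap r w).
Proof.
move=> r0 k1 fin.
have t0 j : (0 <= (kap (iter j thinv w) * r ^+ j)%:E)%E.
  by rewrite lee_fin mulr_ge0 ?exprn_ge0 ?ltW// (lt_le_trans ltr01).
have p0 : (0 <= logB thinv kap r w)%E by apply: nneseries_ge0 => j _ _; exact: t0.
rewrite -lee_fin fineK ?ge0_fin_numE// /logB.
apply: le_trans (nneseries_lim_ge n.+1 _); last by move=> j _ _; exact: t0.
rewrite sumEFin lee_fin /SB big_add1 big_mkord //.
Qed.

Lemma esum_geometric_lty (R : realType) (J : set nat) (u : nat -> \bar R) (C x : R) :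
  0 <= C -> 0 < x < 1 -> (forall n, J n -> (u n <= (C * x ^+ n)%:E)%E) ->
  (\esum_(n in J) u n < +oo)%E.
Proof.
move=> C0 /andP[x0 x1] h.
have g0 n : (0 <= (C * x ^+ n)%:E)%E by rewrite lee_fin mulr_ge0// exprn_ge0 ?ltW.
apply: (@le_lt_trans _ _ (\esum_(n in setT) (C * x ^+ n)%:E)%E).
  by apply: le_esum_cond => n Jn; [exact: g0|right; split; [|exact: h]].
rewrite -nneseries_esumT//; apply: (@le_lt_trans _ _ (C / (1 - x))%:E); last exact: ltry.
apply: lime_le; first by apply: is_cvg_nneseries => n _ _; exact: g0.
apply: nearW => n; rewrite sumEFin lee_fin.
have := @geometric_seriesE R C x; rewrite lt_eqF// => /(_ isT)/(congr1 (fun f => f n)).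
rewrite /series /= => ->; rewrite ler_pM2r ?invr_gt0 ?subr_gt0// ler_piMr//.
by rewrite lerBlDr lerDl exprn_ge0// ltW.
Qed.

Lemma esum_frequently_pinfty (R : realType) (J : set nat) (u : nat -> \bar R) (e : R) :
  0 < e -> (forall n, (0 <= u n)%E) ->
  (forall n0, exists n, [/\ (n0 <= n)%N, J n & (e%:E <= u n)%E]) ->
  (\esum_(n in J) u n)%E = +oo%E.
Proof.
move=> e0 u0 h; rewrite esum_mkcond.
set v := fun n => _; have v0 n : (0 <= v n)%E by rewrite /v; case: ifP.
rewrite -nneseries_esumT//; apply/eqyP => A _.
have [M hM] : exists M : nat, A < M%:R * e.
  exists (Num.truncn (A / e)).+1; rewrite -ltr_pdivrMr//; exact: truncnS_gt.
have [N hN] : exists N, ((M%:R * e)%:E <= \sum_(0 <= i < N) v i)%E.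
  elim: M {hM} => [|M [N IH]]; first by exists 0%N; rewrite big_geq// mul0r.
  have [n [Nn Jn en]] := h N; exists n.+1; rewrite big_nat_recr//=.
  rewrite -natr1 mulrDl mul1r EFinD; apply: leeD; last by rewrite /v mem_set.
  apply: (le_trans IH); rewrite [leRHS](big_cat_nat (n := N))//=; apply: leeDl.
  by apply: sume_ge0 => i _; exact: v0.
apply: (@le_trans _ _ (\sum_(0 <= i < N) v i)%E).
  by apply: le_trans hN; rewrite lee_fin ltW.
by apply: nneseries_lim_ge => i _ _; exact: v0.
Qed.

(** * Pressure *)

Section Pressure.
Context (d : measure_display) (Omega : measurableType d) (R : realType)
  (P : probability Omega R).
Variables (theta thinv : Omega -> Omega).
Hypotheses (th_can : cancel theta thinv) (thinv_can : cancel thinv theta)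
  (th_meas : measurable_fun setT theta) (thinv_meas : measurable_fun setT thinv)
  (th_pres : forall A : set Omega, measurable A -> P (theta @^-1` A) = P A)
  (th_erg : forall A : set Omega, measurable A -> theta @^-1` A = A ->
              P A = 0%E \/ P A = 1%E).
Variables (ell : Omega -> option nat) (alpha : Omega -> nat -> nat -> bool)
  (phi : Omega -> (nat -> nat) -> R).
Hypotheses (ell_meas : forall o : option nat, measurable [set w | ell w = o])
  (ell_gt1 : forall w, ell_lt (ell w) 1)
  (alpha_meas : forall i j : nat, measurable [set w | alpha w i j])
  (rows : {ae P, forall w, forall i : nat, ell_lt (ell w) i ->
            exists j : nat, ell_lt (ell (theta w)) j /\ alpha w i j})
  (phi_meas : measurable_potential theta ell alpha phi).
Variables (r : R) (kap : Omega -> R).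
Hypotheses (hol : holder P theta ell alpha phi 2 r kap)
  (logB_int : (\int[P]_w logB thinv kap r w < +oo)%E)
  (s1 : S1 P theta ell alpha phi) (s2 : S2 P theta ell alpha phi).

Local Notation X := (inX theta ell alpha).
Local Notation RN := (RuelleN theta ell alpha phi).
Local Notation one := (fun _ : nat -> nat => 1%E : \bar R).
Local Notation lsup := (lam_sup theta ell alpha phi).
Local Notation linf := (lam_inf theta ell alpha phi).

Definition Bfun w : R := fine (logB thinv kap r w).
Local Notation reg := (regular theta thinv ell alpha phi kap r Bfun).

Let orbit Q := @ae_orbit d Omega R P theta thinv th_can th_meas thinv_meas th_pres Q.

Lemma r01 : 0 < r < 1. Proof. by case: hol. Qed.
Lemma kap1 w : 1 <= kap w. Proof. by case: hol => _ [_ []]. Qed.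

Lemma logB_ge0 w : (0 <= logB thinv kap r w)%E.
Proof.
apply: nneseries_ge0 => j _ _; rewrite lee_fin mulr_ge0 ?exprn_ge0//.
  by rewrite (le_trans ler01 (kap1 _)).
by case/andP: r01 => /ltW.
Qed.

Lemma meas_logB : measurable_fun setT (logB thinv kap r).
Proof.
have t0 j w : (0 <= (kap (iter j thinv w) * r ^+ j)%:E)%E.
  rewrite lee_fin mulr_ge0 ?exprn_ge0//; last by case/andP: r01 => /ltW.
  by rewrite (le_trans ler01 (kap1 _)).
rewrite (_ : logB thinv kap r = fun w => (\sum_(0 <= j <oo | j \in predT)
   (kap (iter (j + 1) thinv w) * r ^+ (j + 1))%:E)%E); last first.
  apply/funext => w.
  by rewrite /logB -(nneseries_addn 1 (fun j => t0 j w)).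
apply: ge0_emeasurable_sum => [j w _ _|j _]; first exact: t0.
apply/measurable_EFinP; apply: measurable_funM => //.
apply: (measurableT_comp (f := kap)); first by case: hol => _ [].
exact: iterinv_meas.
Qed.

Lemma intble_B : intble P Bfun.
Proof.
apply/integrableP; split.
  by apply/measurable_EFinP; apply: measurableT_comp meas_logB; exact: fine_measurable.
apply: le_lt_trans logB_int; apply: ge0_le_integral => //.
- apply: measurableT_comp => //; apply/measurable_EFinP.
  by apply: measurableT_comp meas_logB; exact: fine_measurable.
- exact: meas_logB.
- move=> w _ /=; have := logB_ge0 w; rewrite /Bfun.
  by case: (logB _ _ _ _) => [x| |]//=; rewrite ?lee_fin ?normr0 ?leey// => /ger0_norm ->.
Qed.

Lemma logB_fin : {ae P, forall w, (logB thinv kap r w < +oo)%E}.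
Proof.
have h : P.-integrable setT (logB thinv kap r).
  apply/integrableP; split; first exact: meas_logB.
  by under eq_integral do rewrite gee0_abs ?logB_ge0//.
by apply: filterS (integrable_ae measurableT h) => w /(_ I); rewrite ge0_fin_numE ?logB_ge0.
Qed.

Lemma ae_holder : {ae P, forall w, holder_at theta ell alpha phi kap r w}.
Proof.
have [_ [_ [_ [_ h]]]] := hol.
apply: filterS h => w hw j x y j2 Xx Xy a; rewrite -lee_fin.
apply: le_trans (hw j j2); apply: ereal_sup_ubound; right.
by exists x, y.
Qed.

Lemma ae_rows : {ae P, forall w, forall k, rows_at theta ell alpha (iter k theta w)}.
Proof. by apply: filterS (orbit rows) => w h k; exact: (h k).1. Qed.

Lemma lsup1_le_Mw : {ae P, forall w, (lsup 1 w <= Mw theta ell alpha phi w)%E}.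
Proof.
apply: filterS ae_rows => w hr; apply: ub_ereal_sup => _ [k _ <-].
apply: ereal_sup_ubound; exists (sec theta ell alpha (word k) (theta w)) => //.
by apply: sec_inX => // n; rewrite -iterSr.
Qed.

Lemma mw_le_linf1 : {ae P, forall w, (mw theta ell alpha phi w <= linf 1 w)%E}.
Proof.
apply: filterS ae_rows => w hr; apply/ereal_infP => _ [k _ <-].
apply: ereal_inf_lbound; exists (sec theta ell alpha (word k) (theta w)) => //.
by apply: sec_inX => // n; rewrite -iterSr.
Qed.

Let m_sup := meas_lam_sup th_meas ell_meas alpha_meas phi_meas.
Let m_inf := meas_lam_inf th_meas ell_meas alpha_meas phi_meas.

(** (S1) controls only the positive part of log Lam_1, (S2) only the negative part of log lam_1.
    Since lam_n <= Lam_n, together they bound both logarithms from both sides. *)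
Definition hi w : R := Num.max (ln (fine (lsup 1 w))) 0.
Definition lo w : R := Num.max (- ln (fine (linf 1 w))) 0.

Lemma meas_ln_fine (f : Omega -> \bar R) : measurable_fun setT f ->
  measurable_fun setT (fun w => ln (fine (f w))).
Proof.
move=> mf; apply: measurableT_comp; first exact: measurable_ln.
by apply: measurableT_comp mf; exact: fine_measurable.
Qed.

Lemma sup_bound : {ae P, forall w, (lsup 1 w < +oo)%E} /\ intble P hi.
Proof.
have mA : measurable [set w | lsup 1 w = +oo%E].
  by rewrite -[X in measurable X]setTI; exact: (m_sup 1 measurableT (emeasurable_set1 _)).
have mh : measurable_fun setT hi.
  by apply: measurable_maxr; [exact: meas_ln_fine (m_sup 1)|exact: measurable_cst].
have [] := @ae_finite_intble _ _ _ P _ hi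
   (fun w => maxe (elog (Mw theta ell alpha phi w)) 0) mA mh _ _ s1 _.
- by move=> w; rewrite le_max lexx orbT.
- by move=> w; rewrite le_max lexx orbT.
- apply: filterS lsup1_le_Mw => w le; split.
    by move=> /= e; move: le; rewrite e leye_eq => /eqP ->.
  have := lam_sup_ge0 theta ell alpha phi 1 w; rewrite /hi.
  (* At +oo, [fine] gives 0 and [ln 0 = 0], so [hi] takes the value 0 there. *)
  move: le; case: (lsup 1 w) => [x| |]// le x0 /=; last first.
    by rewrite ln0// maxxx le_max lexx orbT.
  rewrite EFin_max ge_max; apply/andP; split; last by rewrite le_max lexx orbT.
  move: x0; rewrite lee_fin le_eqVlt => /orP[/eqP <-|x0].
    by rewrite ln0// le_max lexx orbT.
  by rewrite le_max -elog_fin// elog_le.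
by move=> h1 h2; split => //; apply: filterS h1 => w /= /eqP; rewrite ltey.
Qed.

Lemma inf_bound : {ae P, forall w, (0 < linf 1 w)%E} /\ intble P lo.
Proof.
have mA : measurable [set w | linf 1 w = 0%E].
  by rewrite -[X in measurable X]setTI; exact: (m_inf 1 measurableT (emeasurable_set1 _)).
have mh : measurable_fun setT lo.
  apply: measurable_maxr; last exact: measurable_cst.
  by apply: measurableT_comp => //; exact: meas_ln_fine (m_inf 1).
have [] := @ae_finite_intble _ _ _ P _ lo
   (fun w => maxe (- elog (mw theta ell alpha phi w)) 0)%E mA mh _ _ s2 _.
- by move=> w; rewrite le_max lexx orbT.
- by move=> w; rewrite le_max lexx orbT.
- apply: filterS mw_le_linf1 => w le; split.
    move=> /= e; move: le; rewrite e.
    by case: (mw _ _ _ _ _) => [x| |]//=; rewrite lee_fin leNgt => /negbTE ->.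
  have := lam_inf_ge0 theta ell alpha phi 1 w; rewrite /lo.
  move: le; case: (linf 1 w) => [x| |]// le x0 /=; last first.
    by rewrite ln0// oppr0 maxxx le_max lexx orbT.
  rewrite EFin_max ge_max; apply/andP; split; last by rewrite le_max lexx orbT.
  move: x0; rewrite lee_fin le_eqVlt => /orP[/eqP <-|x0].
    by rewrite ln0// oppr0 le_max lexx orbT.
  by rewrite le_max EFinN -elog_fin// leeN2 elog_le.
move=> h1 h2; split => //; apply: filterS h1 => w /= /eqP l0.
by rewrite lt_neqAle eq_sym l0 lam_inf_ge0.
Qed.

Lemma ae_regular : {ae P, forall w, reg w}.
Proof.
have h : {ae P, forall w, holder_at theta ell alpha phi kap r w /\
    (logB thinv kap r w < +oo)%E /\ (lsup 1 w < +oo)%E /\ (0 < linf 1 w)%E}.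
  have h1 : {ae P, forall w, (lsup 1 w < +oo)%E /\ (0 < linf 1 w)%E}.
    by apply: filterS2 sup_bound.1 inf_bound.1 => w a b; split.
  by apply: filterS3 ae_holder logB_fin h1 => w a b c; split; [|split].
apply: filterS2 ae_rows (orbit h) => w hr ho; split => // k; have [[a [b [c e]]] _] := ho k => //.
by move=> n; apply: fine_logB => //; [by case/andP: r01|exact: kap1].
Qed.

(** * The logarithms of the extremal values form subadditive cocycles *)

Definition bsup n w : R := ln (fine (lsup n w)).
Definition binf n w : R := - ln (fine (linf n w)).

Lemma lam_pos n w : reg w -> 0 < fine (lsup n w) /\ 0 < fine (linf n w).
Proof.
move=> rw; have [p f f1 f2] := lam_bounds th_can r01 ell_gt1 n rw.
split; apply: fine_gt0; last by rewrite p ltey_eq f1.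
by rewrite f (lt_le_trans p (lam_inf_le_sup _ _ _ _ _ _)).
Qed.

Lemma lsup_exp n w : reg w -> lsup n w = (expR (bsup n w))%:E.
Proof.
move=> rw; have [p f f1 f2] := lam_bounds th_can r01 ell_gt1 n rw.
by rewrite /bsup lnK ?fineK// posrE; case: (lam_pos n rw).
Qed.

Lemma linf_exp n w : reg w -> linf n w = (expR (- binf n w))%:E.
Proof.
move=> rw; have [p f f1 f2] := lam_bounds th_can r01 ell_gt1 n rw.
by rewrite /binf opprK lnK ?fineK// posrE; case: (lam_pos n rw).
Qed.

Lemma bsupD m n w : reg w -> bsup (m + n) w <= bsup m w + bsup n (iter m theta w).
Proof.
move=> rw; have [p f f1 f2] := lam_bounds th_can r01 ell_gt1 m rw.
have := lam_supD th_can r01 ell_gt1 n rw f2 (lt_le_trans p (lam_inf_le_sup _ _ _ _ _ _)).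
rewrite !lsup_exp//; last exact: regular_iter.
by rewrite -EFinM lee_fin -expRD ler_expR.
Qed.

Lemma binfD m n w : reg w -> binf (m + n) w <= binf m w + binf n (iter m theta w).
Proof.
move=> rw; have [p f f1 f2] := lam_bounds th_can r01 ell_gt1 m rw.
have := lam_infD th_can r01 ell_gt1 n rw f1 p.
rewrite !linf_exp//; last exact: regular_iter.
by rewrite -EFinM lee_fin -expRD ler_expR; lra.
Qed.

Lemma bsub_sup : subadd P theta bsup.
Proof. by apply: filterS ae_regular => w rw m n; exact: bsupD. Qed.

Lemma bsub_inf : subadd P theta binf.
Proof. by apply: filterS ae_regular => w rw m n; exact: binfD. Qed.

Lemma b0_sup : {ae P, forall w, bsup 0 w = 0}.
Proof. by apply: aeW => w; rewrite /bsup (lam0 _ _ _ _ w).1 /= ln1. Qed.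

Lemma b0_inf : {ae P, forall w, binf 0 w = 0}.
Proof. by apply: aeW => w; rewrite /binf (lam0 _ _ _ _ w).2 /= ln1 oppr0. Qed.

Lemma sup_inf_ge0 n w : reg w -> 0 <= bsup n w + binf n w.
Proof.
move=> rw; have := lam_inf_le_sup theta ell alpha phi n w.
rewrite lsup_exp// linf_exp// lee_fin ler_expR; lra.
Qed.

Lemma bsup_le n w : reg w -> bsup n w <= \sum_(i < n) hi (iter i theta w).
Proof.
move=> rw; elim: n => [|n IH].
  by rewrite big_ord0 /bsup (lam0 _ _ _ _ w).1 /= ln1.
rewrite big_ord_recr /= -addn1; apply: le_trans (bsupD n 1 rw) _.
by rewrite lerD// /hi le_max lexx.
Qed.

Lemma binf_le n w : reg w -> binf n w <= \sum_(i < n) lo (iter i theta w).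
Proof.
move=> rw; elim: n => [|n IH].
  by rewrite big_ord0 /binf (lam0 _ _ _ _ w).2 /= ln1 oppr0.
rewrite big_ord_recr /= -addn1; apply: le_trans (binfD n 1 rw) _.
by rewrite lerD// /lo le_max lexx.
Qed.

Lemma intble_hilo n : intble P (fun w => \sum_(i < n) hi (iter i theta w) +
  \sum_(i < n) lo (iter i theta w)).
Proof.
apply: intbleD.
  apply: (intble_sum n (h := fun i w => hi (iter i theta w))) => i.
  exact (intble_iter th_meas th_pres i sup_bound.2).
apply: (intble_sum n (h := fun i w => lo (iter i theta w))) => i.
exact (intble_iter th_meas th_pres i inf_bound.2).
Qed.

Lemma hi_ge0 w : 0 <= hi w. Proof. by rewrite /hi le_max lexx orbT. Qed.
Lemma lo_ge0 w : 0 <= lo w. Proof. by rewrite /lo le_max lexx orbT. Qed.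

Lemma intble_sup n : intble P (bsup n).
Proof.
apply: intble_le (intble_hilo n) _; first exact: meas_ln_fine (m_sup n).
apply: filterS ae_regular => w rw; have := bsup_le n rw; have := binf_le n rw.
have : 0 <= \sum_(i < n) hi (iter i theta w) by apply: sumr_ge0 => i _; exact: hi_ge0.
have : 0 <= \sum_(i < n) lo (iter i theta w) by apply: sumr_ge0 => i _; exact: lo_ge0.
have := sup_inf_ge0 n rw; move=> *; rewrite ler_norml; apply/andP; split; lra.
Qed.

Lemma intble_inf n : intble P (binf n).
Proof.
apply: intble_le (intble_hilo n) _.
  by apply: measurableT_comp => //; exact: meas_ln_fine (m_inf n).
apply: filterS ae_regular => w rw; have := bsup_le n rw; have := binf_le n rw.
have : 0 <= \sum_(i < n) hi (iter i theta w) by apply: sumr_ge0 => i _; exact: hi_ge0.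
have : 0 <= \sum_(i < n) lo (iter i theta w) by apply: sumr_ge0 => i _; exact: lo_ge0.
have := sup_inf_ge0 n rw; move=> *; rewrite ler_norml; apply/andP; split; lra.
Qed.

Definition near_linear (b : nat -> Omega -> R) (gam : R) w :=
  forall e, 0 < e -> exists n0, forall n, (n0 <= n)%N -> `|b n w - gam * n%:R| <= e * n%:R.

Lemma E_lower (f h : Omega -> R) n : intble P f -> intble P h ->
  {ae P, forall w, - (\sum_(i < n) h (iter i theta w)) <= f w} ->
  - (\int[P]_w h w) * n%:R <= \int[P]_w f w.
Proof.
move=> fI hI le.
have hI' i : intble P (fun w => h (iter i theta w)) by exact: (intble_iter th_meas th_pres).
have sI : intble P (fun w => \sum_(i < n) h (iter i theta w)).
  exact: (intble_sum n (h := fun i w => h (iter i theta w))).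
have -> : - (\int[P]_w h w) * n%:R = \int[P]_w ((-1) * \sum_(i < n) h (iter i theta w)).
  rewrite RintegralZl// mulN1r mulNr (Esum n hI'); congr (- _).
  under eq_bigr do rewrite (E_iter th_meas th_pres)//.
  by rewrite sumr_const card_ord mulr_natr.
apply: Eae_le => //; first exact: intbleZ.
by apply: filterS le => w; rewrite mulN1r.
Qed.

Lemma limit_sup : exists gam : R, (forall n, gam * n%:R <= \int[P]_w bsup n w) /\
  {ae P, forall w, near_linear bsup gam w}.
Proof.
apply: (kingman th_can th_meas thinv_meas th_pres th_erg (C := - \int[P]_w lo w)
  b0_sup intble_sup bsub_sup) => n.
apply: E_lower; [exact: intble_sup|exact: inf_bound.2|].
apply: filterS ae_regular => w rw; have := sup_inf_ge0 n rw; have := binf_le n rw; lra.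
Qed.

Lemma limit_inf : exists gam : R, {ae P, forall w, near_linear binf gam w}.
Proof.
have [|gam [_ h]] := kingman th_can th_meas thinv_meas th_pres th_erg (C := - \int[P]_w hi w)
  b0_inf intble_inf bsub_inf; last by exists gam.
move=> n; apply: E_lower; [exact: intble_inf|exact: sup_bound.2|].
apply: filterS ae_regular => w rw; have := sup_inf_ge0 n rw; have := bsup_le n rw; lra.
Qed.

(** * Consequences of mixing and of the big image and preimage properties *)

Hypothesis mix : top_mixing P theta ell alpha.
Variables (Obi : set Omega) (Ibi : Omega -> seq nat).
Hypothesis bi : big_image_prop P thinv ell alpha Obi Ibi.
Variables (Obp : set Omega) (Ibp : Omega -> seq nat).
Hypothesis bp : big_preimage_prop P thinv ell alpha Obp Ibp.
Hypothesis var1 : {ae P, forall w, (Obi `|` Obp) (theta w) ->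
  (Var_phi theta ell alpha phi 1 w < +oo)%E}.

Lemma Omega_w1 b w : Omega_w theta ell alpha [:: b] w <-> ell_lt (ell w) b.
Proof.
split=> [[h _]|h]; first exact: (h 0%N).
by split=> [[|i]|i].
Qed.

Lemma mset_Omega_w1 b : measurable (Omega_w theta ell alpha [:: b]).
Proof.
rewrite (_ : Omega_w _ _ _ _ = [set w | ell_lt (ell w) b]); first exact: mset_ell.
by apply/seteqP; split => w /Omega_w1.
Qed.

(** Mixing concerns letters of positive probability; almost surely no other letter occurs. *)
Lemma ae_letters : {ae P, forall w, forall b, ell_lt (ell w) b -> inW P theta ell alpha [:: b]}.
Proof.
apply: ae_foralln => b; have [h|] := ae_not_or_pos P (mset_Omega_w1 b).
  by apply: aeW.
by apply: filterS => w nw lb; exfalso; apply: nw; apply/Omega_w1.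
Qed.

Lemma Var1_le w : (Var_phi theta ell alpha phi 1 w < +oo)%E ->
  exists V, var1_le theta ell alpha phi w V.
Proof.
move=> fin; have p0 : (0 <= Var_phi theta ell alpha phi 1 w)%E.
  by apply: ereal_sup_ubound; left.
exists (fine (Var_phi theta ell alpha phi 1 w)) => x y Xx Xy xy.
rewrite -lee_fin fineK ?ge0_fin_numE//; apply: ereal_sup_ubound; right.
by exists x, y; do 3 split => //; move=> [].
Qed.

(** The finite sets [Ibp] vary with w without measurability; a uniform bound on the letters gives a
    measurable event instead. *)
Definition bp_below K : set Omega := [set w | Obp w /\ forall c, ell_lt (ell w) c ->
  exists b, [/\ (b < K)%N, ell_lt (ell (thinv w)) b & alpha (thinv w) b c]].

Lemma bp_below_meas K : measurable (bp_below K).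
Proof.
have [mO _] := bp; apply: mset_and => //; apply: mset_all => c.
apply: mset_imp; first exact: mset_ell.
apply: mset_ex => b.
rewrite (_ : [set w | _] = [set w | (b < K)%N /\ (ell_lt (ell (thinv w)) b /\ alpha (thinv w) b c)]).
  apply: mset_and; first exact: mset_const.
  apply: mset_and.
    exact: (preimage_meas thinv_meas (mset_ell ell_meas b)).
  exact: (preimage_meas thinv_meas (alpha_meas b c)).
by apply/seteqP; split => w; [move=> []|move=> [? []]].
Qed.

Lemma bp_below_pos : exists K, (0 < P (bp_below K))%E.
Proof.
have [mO [PO h]] := bp.
apply: (pos_cover mO PO bp_below_meas); apply: aeW => w Ow.
have [h1 h2] := h w Ow.
have [K hK] : exists K, forall b, b \in Ibp w -> (b < K)%N.
  apply: (seq_bound 0%N (Q := fun b K => (b < K)%N)) => [b D D'|b _].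
    by rewrite leEnat => DD' /leq_trans; apply.
  by exists b.+1.
exists K; split => // c /h2[b bI bc]; exists b; split => //; [exact: hK|exact: h1].
Qed.

Definition connected w (I : seq nat) q D := forall b, b \in I ->
  forall x, X (iter q theta w) x -> exists y,
    [/\ X w y, y 0%N = b, shiftk q y = x & - D <= birkhoff theta phi q w y].

(** A return to [bp_below K] after the mixing times of all pairs from [I] and the letters below [K]
    supplies q. The set [I] is quantified after w because it will be the random set of big
    images. *)
Lemma ae_connected : {ae P, forall w, forall I : seq nat,
  (forall b, b \in I -> ell_lt (ell w) b) -> exists q D, connected w I q D}.
Proof.
have [K PK] := bp_below_pos.
have h1 := recurrence th_meas th_pres th_erg (bp_below_meas K) PK.
have h2 : {ae P, forall w, reg w /\ forall k, ((Obi `|` Obp) (theta (iter k theta w)) ->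
  (Var_phi theta ell alpha phi 1 (iter k theta w) < +oo)%E)}.
  by apply: filterS2 ae_regular (orbit var1) => w rw h; split => // k; exact: (h k).1.
apply: filterS3 h1 h2 (orbit ae_letters) => w rec [rw V1] let_ I hI.
have [M hM] : exists M, forall b, b \in I -> forall b', b' \in iota 0 K ->
    forall n, (M <= n)%N -> ell_lt (ell (iter n theta w)) b' ->
    exists z, [/\ X w z, z 0%N = b & z n = b'].
  apply: (seq_bound 0%N (Q := fun b M => forall b', b' \in iota 0 K ->
    forall n, (M <= n)%N -> ell_lt (ell (iter n theta w)) b' ->
    exists z, [/\ X w z, z 0%N = b & z n = b'])) => [b D D'|b bI].
    by rewrite leEnat => DD' h b' b'K n D'n; apply: h => //; exact: leq_trans D'n.
  apply: (seq_bound 0%N (Q := fun b' M => forall n, (M <= n)%N ->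
    ell_lt (ell (iter n theta w)) b' ->
    exists z, [/\ X w z, z 0%N = b & z n = b'])) => [b' D D'|b' b'K].
    by rewrite leEnat => DD' h n D'n; apply: h => //; exact: leq_trans D'n.
  have lb := hI b bI; have Wb := (let_ 0%N).1 _ lb.
  have [Wb'|nWb'] := pselect (inW P theta ell alpha [:: b']); last first.
    by exists 0%N => n _ lb'; exfalso; apply: nWb'; exact: (let_ n).1.
  have [Nbb [_ hN]] := mix Wb Wb'.
  exists (Nbb w) => n Nn lb'.
  have [||z [Xz [z0 zn]]] := hN w n _ Nn _; [exact/Omega_w1|exact/Omega_w1|].
  by exists z.
(* The big preimage concerns the step into time q + 1, so mixing must act up to time q >= M. *)
have [[//|q] Mq [Oq hq]] := rec M.+1.
have thq : thinv (iter q.+1 theta w) = iter q theta w by rewrite iterS th_can.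
have [V hV] := Var1_le (V1 q (or_intror Oq)).
have [D hD] : exists D : R, connected w I q.+1 D.
  have := connecting_words th_can (reg_holder rw) hV (I := I) (K := K); apply.
  - by move=> c /hq; rewrite thq.
  - move=> b b' bI lb' b'K; apply: hM => //; by rewrite mem_iota.
by exists q.+1, D.
Qed.

(** * Comparison of the extremal values at good times *)

Variables (Os : set Omega).
Hypotheses (mOs : measurable Os) (POs : (0 < P Os)%E).

(** A set of endpoints with a condition on every past, so that recurrence applies to it. Natural
    constants allow countable covers, and the visit to [Os] after q more steps places the comparison
    time in J. *)
Definition comparable k q : set Omega := [set eta | Os (iter q theta eta) /\
  forall n, (lsup n.+1 (iter n.+1 thinv eta) <=
     k%:R%:E * linf (n.+1 + q) (iter n.+1 thinv eta))%E].

Lemma comparable_meas k q : measurable (comparable k q).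
Proof.
apply: mset_and; first exact: (mset_iter th_meas (A := Os)).
apply: mset_all => n; rewrite -[X in measurable X]setTI.
apply: measurable_lee => //.
  exact: (measurableT_comp (m_sup n.+1) (iterinv_meas thinv_meas n.+1)).
apply: emeasurable_funM => //.
exact: (measurableT_comp (m_inf (n.+1 + q)) (iterinv_meas thinv_meas n.+1)).
Qed.

Lemma comparable_pos : exists k q, (0 < P (comparable k q))%E.
Proof.
have [mO [PO hbi]] := bi.
suff cov : {ae P, forall w, Obi w -> exists q, (\bigcup_k comparable k q) w}.
  have [|q Pq] := pos_cover mO PO _ cov.
    by move=> q; apply: bigcup_measurable => k _; exact: comparable_meas.
  have mU : measurable (\bigcup_k comparable k q).
    by apply: bigcup_measurable => k _; exact: comparable_meas.
  have [|k Pk] := pos_cover mU Pq (fun k => comparable_meas k q).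
    by apply: aeW => w [k _ h]; exists k.
  by exists k, q.
have h1 := orbit ae_regular; have h2 := orbit var1.
have h3 := orbit (recurrence th_meas th_pres th_erg mOs POs).
have h12 := ae_and h1 h2.
apply: filterS3 h12 h3 ae_connected => eta [g1 g2] g3 g4 Oeta.
have [hI1 hI2] := hbi eta Oeta.
have [q [D hD]] := g4 _ hI1.
have [V hV] : exists V, var1_le theta ell alpha phi (thinv eta) V.
  by apply: Var1_le; apply: (g2 1%N).2 => /=; rewrite thinv_can; left.
(* The connecting word need not end in [Os]; s further steps lead there. *)
have [s _ Oss] := (g3 q).1 0%N.
have [k hk] := compare_sup_inf th_can thinv_can r01 ell_gt1 s (g1 1%N).2 hV hI2 hI1 hD.
exists (q + s)%N, k => //; split; first by rewrite addnC iterD.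
by move=> n; apply: hk; [exact: (g1 n.+1).2|exact: iterKV].
Qed.

(** The factor k is bounded by [exp k], which also covers k = 0. *)
Lemma comparable_iter k q n w : reg w -> comparable k q (iter n.+1 theta w) ->
  bsup n.+1 w <= k%:R - binf (n.+1 + q) w.
Proof.
move=> rw [_ /(_ n)]; rewrite (iterK th_can) lsup_exp// linf_exp//.
rewrite -EFinM lee_fin -ler_expR expRD => /le_trans; apply.
by rewrite ler_wpM2r ?expR_ge0// (le_trans _ (expR_ge1Dx _))// lerDr.
Qed.

(* Both growth rates coincide since the two cocycles are comparable infinitely often. *)
Lemma pressure_limit : exists PG : R, (forall n, PG * n%:R <= \int[P]_w bsup n w) /\
  {ae P, forall w, near_linear bsup PG w /\ near_linear binf (- PG) w}.
Proof.
have [g [Eg hg]] := limit_sup; have [c hc] := limit_inf.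
suff cE : c = - g by exists g; split => //; rewrite -cE; apply: filterS2 hg hc.
have [k [q Pkq]] := comparable_pos.
have h1 := ae_and hg hc.
have h2 := recurrence th_meas th_pres th_erg (comparable_meas k q) Pkq.
have [w [[gw cw] [rec rw]]] := ae_ex (ae_and h1 (ae_and h2 ae_regular)).
apply/eqP; rewrite eq_le; apply/andP; split; rewrite leNgt; apply/negP => lt.
  pose e := (c + g) / 4.
  have e0 : 0 < e by rewrite /e; lra.
  have [n1 h1'] := gw e e0; have [n2 h2'] := cw e e0.
  (* Since c + g = 4e, comparability at time m would give [2 * e * m <= k - (c - e) * q], that is m
     <= C. *)
  pose C := (k%:R - (c - e) * q%:R) / (2 * e).
  have [T hT] : exists T : nat, C < T%:R by exists (Num.truncn C).+1; exact: truncnS_gt.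
  have [N] := rec (n1 + n2 + T.+1)%N.
  case: N => [|n] nN hn; first by rewrite addnS in nN.
  have := comparable_iter rw hn.
  have := h1' n.+1 ltac:(lia); have := h2' (n.+1 + q)%N ltac:(lia).
  have : C < n.+1%:R by apply: lt_le_trans hT _; rewrite ler_nat; lia.
  have e2 : 0 < 2 * e by lra.
  rewrite /C (ltr_pdivrMr _ _ e2) (natrD _ n.+1 q).
  set m := n.+1%:R; rewrite !ler_norml => a0 /andP[a1 a2] /andP[a3 a4] a5.
  have : e * 4 * m = (c + g) * m by rewrite /e; field.
  lra.
(* The other inequality follows from lam_n <= Lam_n at a single large time. *)
pose e := - (c + g) / 4.
have e0 : 0 < e by rewrite /e; lra.
have [n1 h1'] := gw e e0; have [n2 h2'] := cw e e0.
have := sup_inf_ge0 (maxn n1 n2).+1 rw.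
have := h1' (maxn n1 n2).+1 ltac:(lia); have := h2' (maxn n1 n2).+1 ltac:(lia).
have : 0 < (maxn n1 n2).+1%:R :> R by rewrite ltr0n.
set m := _.+1%:R => m0; rewrite !ler_norml => /andP[a1 a2] /andP[a3 a4] a5.
have : 0 < e * m by rewrite mulr_gt0.
have : e * 4 * m = - (c + g) * m by rewrite /e; field.
lra.
Qed.

(** * The Gurevič pressure and the generating series *)

Variables (a : nat) (xi : Omega -> nat -> nat).
Hypotheses (Os_a : forall w, Os w -> ell_lt (ell w) a)
  (xi_X : {ae P, forall w, X w (xi w) /\
            (Omega_w theta ell alpha [:: a] w -> xi w 0%N = a)}).
Local Notation Z := (Zn theta ell alpha phi a).
Local Notation cZ := (calZ theta ell alpha phi xi).

Lemma Z_upper n w : reg w -> (0 < n)%N -> X (iter n theta w) (xi (iter n theta w)) ->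
  xi (iter n theta w) 0%N = a ->
  (Z n w <= (expR (Bfun (iter n theta w) + bsup n w))%:E)%E.
Proof.
move=> rw n0 Xx xa.
apply: (le_trans (Zn_upper th_can n0 (reg_holder rw) Xx xa)).
rewrite expRD EFinM -(lsup_exp n rw); apply: lee_pmul.
- by rewrite lee_fin expR_ge0.
- exact: RuelleN_ge0.
- rewrite lee_fin ler_expR; have /andP[r0 r1] := r01.
  have hB := reg_B rw n n; have B0 := B_ge0 (regular_iter n rw).
  apply: (@le_trans _ _ (r * Bfun (iter n theta w))); first by rewrite ler_wpM2l// ltW.
  by rewrite ler_piMl// ltW.
  apply: (lam_sup_ub th_can r01 ell_gt1 rw Xx).
Qed.

(** A connecting word that starts with a is put in front, at cost [D]; the remaining n steps are
    bounded below by the infimum at time m. *)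
Lemma Z_lower m n D w : reg w -> (0 < m + n)%N -> connected w [:: a] m D ->
  X (iter (m + n) theta w) (xi (iter (m + n) theta w)) ->
  xi (iter (m + n) theta w) 0%N = a ->
  ((expR (- D - binf n (iter m theta w)))%:E <= Z (m + n) w)%E.
Proof.
move=> rw mn0 hD Xx xa.
apply: le_trans (Zn_lower phi mn0 Xx xa); rewrite RuelleN_add.
have rm := regular_iter m rw.
have Xx' : X (iter n theta (iter m theta w)) (xi (iter (m + n) theta w)).
  by rewrite -iterD addnC.
apply: (@le_trans _ _ (RN n (iter m theta w) (fun y => ((expR (- D))%:E * one y)%E)
    (xi (iter (m + n) theta w)))).
  rewrite RuelleN_Z ?expR_gt0// expRD EFinM -(linf_exp n rm).
  apply: lee_wpmul2l; first by rewrite lee_fin expR_ge0.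
  exact: (lam_inf_lb th_can r01 ell_gt1 rm Xx').
apply: RuelleN_le => // y Xy; rewrite mule1.
have [z [Xz z0 <- Dz]] := hD a (mem_head _ _) y Xy.
pose fa (y : nat -> nat) : \bar R := if y 0%N == a then 1%E else 0%E.
have fa0 y' : (0 <= fa y')%E by rewrite /fa; case: ifP.
apply: le_trans (RuelleN_ge_orbit phi m Xz fa0); rewrite /fa.
by rewrite z0 eqxx mule1 lee_fin ler_expR.
Qed.

Lemma pressure_cvg PG :
  {ae P, forall w, near_linear bsup PG w /\ near_linear binf (- PG) w} ->
  {ae P, forall w, Os w -> cvg_along (Jset theta Os w)
     (fun n => (elog (Z n w) * (n%:R^-1)%:E)%E) PG}.
Proof.
move=> lim.
have sub := orbit_sublinear th_can th_meas thinv_meas th_pres th_erg intble_B.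
apply: filterS3 (ae_and ae_regular ae_connected) (ae_and (orbit lim) sub) (orbit xi_X).
move=> w [rw con] [li subw] xiw Ow e e0.
have [m [D hD]] : exists m D, connected w [:: a] m D.
  by apply: con => b; rewrite inE => /eqP ->; exact: Os_a.
have e40 : 0 < e / 4 by lra.
have [n1 h1] := (li 0%N).1.1 _ e40.
have [n2 h2] := (li m).1.2 _ e40.
have [n3 h3] := subw _ e40.
(* [m] and [D] depend on w but not on n, so beyond [C] the connecting cost and the time shift fit
   into [e / 4]. *)
pose C := (D + PG * m%:R) / (e / 4).
have [T hT] : exists T : nat, C < T%:R by exists (Num.truncn C).+1; exact: truncnS_gt.
exists (n1 + (n2 + m) + n3 + T)%N => n nn [n0 On].
have mn : n = (m + (n - m))%N by lia.
have [Xx xa] := (xiw n).1; have {}xa := xa ((Omega_w1 a _).2 (Os_a On)).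
have up := Z_upper rw n0 Xx xa.
have low : ((expR (- D - binf (n - m) (iter m theta w)))%:E <= Z n w)%E.
  by rewrite [in leRHS]mn; apply: Z_lower; rewrite -?mn.
move: up low; case: (Z n w) => [z| |]// up low.
rewrite !lee_fin in up low.
have z0 : 0 < z by apply: lt_le_trans low; exact: expR_gt0.
rewrite elog_fin// -EFinM; exists (ln z / n%:R); split => //.
have nR : 0 < n%:R :> R by rewrite ltr0n.
have {}up : ln z <= Bfun (iter n theta w) + bsup n w by rewrite -ler_expR lnK// posrE.
have {}low : - D - binf (n - m) (iter m theta w) <= ln z by rewrite -ler_expR lnK// posrE.
have -> : ln z / n%:R - PG = (ln z - PG * n%:R) / n%:R by field; rewrite gt_eqF.
rewrite normrM normfV (gtr0_norm nR) ltr_pdivrMr//.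
have := h1 n ltac:(lia); have := h2 (n - m)%N ltac:(lia); have := h3 n ltac:(lia).
rewrite natrB; last by lia.
have : C < n%:R by apply: lt_le_trans hT _; rewrite ler_nat; lia.
rewrite /C (ltr_pdivrMr _ _ e40).
have : 0 <= e / 4 * m%:R by rewrite mulr_ge0// ltW.
have : 0 < e * n%:R by rewrite mulr_gt0.
rewrite !ler_norml ltr_norml => b1 b2 b3 /andP[b4 b5] /andP[b6 b7] /andP[b8 b9].
by apply/andP; split; lra.
Qed.

Lemma calZ_between n w : reg w -> X (iter n theta w) (xi (iter n theta w)) ->
  ((expR (- binf n w))%:E <= cZ n w <= (expR (bsup n w))%:E)%E.
Proof.
move=> rw Xx; rewrite -linf_exp// -lsup_exp//; apply/andP; split.
  exact: (lam_inf_lb th_can r01 ell_gt1 rw Xx).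
exact: (lam_sup_ub th_can r01 ell_gt1 rw Xx).
Qed.

Lemma series_lty PG :
  {ae P, forall w, near_linear bsup PG w} ->
  {ae P, forall w, forall s : R, 0 < s < expR (- PG) ->
    (\esum_(n in Jset theta Os w) ((s ^+ n)%:E * cZ n w) < +oo)%E}.
Proof.
move=> lim; apply: filterS3 ae_regular lim (orbit xi_X) => w rw li xiw s /andP[s0 s1'].
have lns : ln s < - PG by rewrite -ltr_expR lnK// posrE.
(* Half of the exponential gap is given to the error of the limit; the other half remains as the
   geometric rate [exp(- e)]. *)
pose e := (- PG - ln s) / 2; have e0 : 0 < e by rewrite /e; lra.
have [n0 h] := li e e0.
pose f n := n%:R * ln s + bsup n w + e * n%:R.
have [C hC] : exists C, forall n, f n <= C.
  exists (\sum_(i < n0) `|f i|) => n; have [lt|ge] := ltnP n n0.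
    rewrite (bigD1 (Ordinal lt))//=; apply: le_trans (ler_norm _) _.
    by rewrite lerDl sumr_ge0.
  apply: (@le_trans _ _ 0); last exact: sumr_ge0.
  have := h n ge; rewrite ler_norml => /andP[_].
  have : e * 2 * n%:R = (- PG - ln s) * n%:R by rewrite /e; field.
  by rewrite /f; lra.
apply: (@esum_geometric_lty _ _ _ (expR C) (expR (- e))).
- exact: expR_ge0.
- by rewrite expR_gt0 -expR0 ltr_expR oppr_lt0.
move=> n _; have /andP[_ up] := calZ_between rw (xiw n).1.1.
apply: (@le_trans _ _ ((s ^+ n)%:E * (expR (bsup n w))%:E)%E).
  by apply: lee_wpmul2l => //; rewrite lee_fin exprn_ge0// ltW.
have sE : s = expR (ln s) by rewrite lnK// posrE.
rewrite -EFinM lee_fin {1}sE -!expRM_natl -!expRD ler_expR.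
by have := hC n; rewrite /f; lra.
Qed.

Lemma series_pinfty PG : (forall n, PG * n%:R <= \int[P]_w bsup n w) ->
  {ae P, forall w, (\esum_(n in Jset theta Os w) ((expR (- PG) ^+ n)%:E * cZ n w))%E = +oo%E}.
Proof.
move=> EPG; have [k [q Pkq]] := comparable_pos.
pose b n w := bsup n w + - PG * n%:R.
have bI n : intble P (b n) by apply: intbleD; [exact: intble_sup|exact: intble_cst].
have rec : {ae P, forall w, exists t : R, forall n0, exists n,
    [/\ (n0 <= n)%N, comparable k q (iter n theta w) & t <= b n w]}.
  apply: (subadd_recurrent th_can th_meas thinv_meas th_pres th_erg _ bI) => //.
  - by apply: filterS b0_sup => w h; rewrite /b h mulr0 addr0.
  - by apply: filterS bsub_sup => w h m n; have := h m n; rewrite /b natrD; lra.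
  - exact: comparable_meas.
  - move=> n; rewrite /b RintegralD//; [|exact: intble_sup|exact: intble_cst].
    by rewrite Ecst; have := EPG n; lra.
apply: filterS3 ae_regular rec (orbit xi_X) => w rw [t ht] xiw.
(* [t] comes from the recurrence, [k] from comparability, and [PG * q] from moving on q steps to a
   visit of [Os]. *)
apply: (@esum_frequently_pinfty _ _ _ (expR (t - k%:R - PG * q%:R))).
- exact: expR_gt0.
- by move=> n; rewrite mule_ge0 ?RuelleN_ge0// lee_fin exprn_ge0// expR_ge0.
move=> n0; have [[|n] [nn Gn tn]] := ht n0.+1; first by [].
exists (n.+1 + q)%N; split.
- by lia.
- by split; [lia|rewrite addnC iterD; exact: Gn.1].
have /andP[low _] := calZ_between rw (xiw (n.+1 + q)%N).1.1.
apply: (@le_trans _ _ ((expR (- PG) ^+ (n.+1 + q))%:E * (expR (- binf (n.+1 + q) w))%:E)%E); last first.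
  by apply: lee_wpmul2l => //; rewrite lee_fin exprn_ge0// expR_ge0.
rewrite -EFinM lee_fin -expRM_natl -expRD ler_expR.
have := comparable_iter rw Gn; move: tn; rewrite /b (natrD _ n.+1 q); lra.
Qed.

End Pressure.

Theorem theorem3p4
  (d : measure_display) (Omega : measurableType d) (R : realType)
  (P : probability Omega R)
  (* theta : invertible, bimeasurable, P-preserving, ergodic *)
  (theta thinv : Omega -> Omega)
  (th_can : cancel theta thinv) (thinv_can : cancel thinv theta)
  (th_meas : measurable_fun setT theta) (thinv_meas : measurable_fun setT thinv)
  (th_pres : forall A : set Omega, measurable A -> P (theta @^-1` A) = P A)
  (th_erg : forall A : set Omega, measurable A -> theta @^-1` A = A ->
              P A = 0%E \/ P A = 1%E)
  (* the random alphabet sizes ell_omega in N \cup {oo} (None = oo), ell > 1 *)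
  (ell : Omega -> option nat)
  (ell_meas : forall o : option nat, measurable [set w | ell w = o])
  (ell_gt1 : forall w, ell_lt (ell w) 1)
  (* the random 0-1 matrices A_omega, every row containing a 1 *)
  (alpha : Omega -> nat -> nat -> bool)
  (alpha_meas : forall i j : nat, measurable [set w | alpha w i j])
  (rows : {ae P, forall w, forall i : nat, ell_lt (ell w) i ->
            exists j : nat, ell_lt (ell (theta w)) j /\ alpha w i j})
  (* b.i.p.-property *)
  (mix : top_mixing P theta ell alpha)
  (Obi : set Omega) (Ibi : Omega -> seq nat)
  (bi : big_image_prop P thinv ell alpha Obi Ibi)
  (Obp : set Omega) (Ibp : Omega -> seq nat)
  (bp : big_preimage_prop P thinv ell alpha Obp Ibp)
  (* the potential, satisfying (H* ), (S1), (S2) *)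
  (phi : Omega -> (nat -> nat) -> R)
  (phi_meas : measurable_potential theta ell alpha phi)
  (hstar : Hstar P theta thinv ell alpha phi Obi Obp)
  (s1 : S1 P theta ell alpha phi)
  (s2 : S2 P theta ell alpha phi)
  (* the fixed symbol a in W^1 and the measurable family xi *)
  (a : nat) (Ha : inW P theta ell alpha [:: a])
  (xi : Omega -> nat -> nat)
  (xi_meas : forall i k : nat, measurable [set w | xi w i = k])
  (xi_X : {ae P, forall w, inX theta ell alpha w (xi w) /\
            (Omega_w theta ell alpha [:: a] w -> xi w 0%N = a)})
  (* N_aa from topological mixing and N with P(Omega^* ) > 0 *)
  (Naa : Omega -> nat) (Naa_rv : nat_rv Naa)
  (Naa_mix : mixing_for theta ell alpha a a Naa)
  (N : nat) (HN : (0 < P (Ostar theta ell alpha a Naa N))%E) :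
  (* P_G(phi) exists as the a.s. relative Gurevic pressure and is finite ... *)
  exists PG : R,
    {ae P, forall w, Ostar theta ell alpha a Naa N w ->
       cvg_along (Jset theta (Ostar theta ell alpha a Naa N) w)
         (fun n => (elog (Zn theta ell alpha phi a n w) * (n%:R^-1)%:E)%E) PG} /\
  (* ... and the dichotomy for the series holds for a.e. omega *)
    {ae P, forall w,
       (forall s : R, 0 < s < expR (- PG) ->
          (\esum_(n in Jset theta (Ostar theta ell alpha a Naa N) w)
             ((s ^+ n)%:E * calZ theta ell alpha phi xi n w) < +oo)%E) /\
       (\esum_(n in Jset theta (Ostar theta ell alpha a Naa N) w)
          ((expR (- PG) ^+ n)%:E * calZ theta ell alpha phi xi n w))%E = +oo%E}.
Proof.
have [[r [kap [hol logB_int]]] var1] := hstar.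
pose Os := Ostar theta ell alpha a Naa N.
have mOs : measurable Os.
  apply: mset_and; first exact: mset_Omega_w1.
  rewrite (_ : [set w | _] = [set w | exists k, (k <= N)%N /\ Naa w = k]).
    by apply: mset_ex => k; apply: mset_and; [exact: mset_const|exact: Naa_rv].
  by apply/seteqP; split => w /=; [move=> h; exists (Naa w)|move=> [k [h ->]]].
have Os_a w : Os w -> ell_lt (ell w) a by move=> [/Omega_w1].
have [PG [EPG lim]] := pressure_limit th_can thinv_can th_meas thinv_meas th_pres th_erg
  ell_meas ell_gt1 alpha_meas rows phi_meas hol logB_int s1 s2 mix bi bp var1 mOs HN.
exists PG; split.
  exact: (pressure_cvg th_can th_meas thinv_meas th_pres th_erg
    ell_meas ell_gt1 alpha_meas rows phi_meas hol logB_int s1 s2 mix bp var1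
    (Os := Os) HN Os_a xi_X lim).
apply: ae_and.
  apply: (series_lty th_can th_meas thinv_meas th_pres ell_meas ell_gt1 alpha_meas
    rows phi_meas hol logB_int s1 s2 Os xi_X).
  by apply: filterS lim => w [].
exact: (series_pinfty th_can thinv_can th_meas thinv_meas th_pres th_erg
  ell_meas ell_gt1 alpha_meas rows phi_meas hol logB_int s1 s2 mix bi bp var1
  mOs HN xi_X EPG).
Qed.
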